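(* For integers $k\ge2$ and $n\ge0$ let \[ J_k(n)=\sum_{r=1}^{k-1}2^k\int_{[0,1]^k}\frac{(1-u_1^4\cdots u_r^4)^n(1-u_{r+1}^4\cdots u_k^4)^n}{(1-u_1^2\cdots u_k^2)^{2n+1}}\,du_1\cdots du_k , \] and set $J_0(n)=0$ and $J_1(n)=\dfrac{2^nn!}{(2n+1)!!}$ for $n\ge0$. Then for all $k\ge2$ and $n\ge2$, \[ 4n^2J_k(n)-(8n^2-8n+3)J_k(n-1)+4(n-1)^2J_k(n-2)=4J_{k-2}(n-1). \] *)

(* Defs.v *)
From HB Require Import structures.
From mathcomp Require Import all_boot all_order all_algebra.
From mathcomp Require Import all_classical all_reals all_analysis.

Set Implicit Arguments.
Unset Strict Implicit.
Unset Printing Implicit Defensive.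

Import Order.TTheory GRing.Theory Num.Theory.
Import numFieldNormedType.Exports.

Local Open Scope classical_set_scope.
Local Open Scope ring_scope.

Definition tcons (T : Type) (k : nat) (p : T * k.-tuple T) : k.+1.-tuple T :=
  [tuple of p.1 :: p.2].

Section cons_measure.
Context {R : realType}.
Local Notation T := (measurableTypeR R).

Lemma measurable_tcons (k : nat) :
  measurable_fun [set: T * k.-tuple T] (@tcons T k).
Proof. exact: measurable_cons. Qed.

Variables (k : nat) (mu : {sigma_finite_measure set (k.-tuple T) -> \bar R}).

Definition cons_measure : set (k.+1.-tuple T) -> \bar R :=
  pushforward (@lebesgue_measure R \x mu)%E (@tcons T k).

Let pf : {measure set (k.+1.-tuple T) -> \bar R} :=
  measure_function_pushforward__canonical__measure_function_Measure
    (@lebesgue_measure R \x mu)%E (@measurable_tcons k).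

Let cons_measure0 : cons_measure set0 = 0%E.
Proof. exact: (measure0 pf). Qed.

Let cons_measure_ge0 A : (0 <= cons_measure A)%E.
Proof. exact: (measure_ge0 pf). Qed.

Let cons_measure_sigma_additive : semi_sigma_additive cons_measure.
Proof. exact: (@measure_semi_sigma_additive _ _ _ pf). Qed.

HB.instance Definition _ := isMeasure.Build _ _ _ cons_measure
  cons_measure0 cons_measure_ge0 cons_measure_sigma_additive.

Let cons_measure_sigma_finite : sigma_finite setT cons_measure.
Proof.
have /sigma_finiteP[F [TF ndF Foo]] := sigma_finiteT (@lebesgue_measure R).
have /sigma_finiteP[G [TG ndG Goo]] := sigma_finiteT mu.
pose H n : set (k.+1.-tuple T) :=
  [set u : k.+1.-tuple T | F n (thead u)] `&`
  [set u : k.+1.-tuple T | G n [tuple of behead u]].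
exists H.
  apply/seteqP; split => // u _.
  have [i _ Fi] : (\bigcup_i F i) (thead u) by rewrite -TF.
  have [j _ Gj] : (\bigcup_i G i) [tuple of behead u] by rewrite -TG.
  exists (maxn i j) => //; split.
    by have /subsetPset := ndF _ _ (leq_maxl i j); apply.
  by have /subsetPset := ndG _ _ (leq_maxr i j); apply.
move=> n; have [mF Fn] := Foo n; have [mG Gn] := Goo n; split.
  apply: measurableI; rewrite -[X in measurable X]setTI.
    exact: measurable_tnth.
  exact: measurable_behead.
rewrite /cons_measure /pushforward (_ : _ @^-1` _ = F n `*` G n).
  by rewrite product_measure1E// lte_mul_pinfty// ge0_fin_numE.
have tbE x (t : k.-tuple T) : [tuple of behead (tcons (x, t))] = t.
  exact/val_inj.
by apply/seteqP; split=> -[x t] /=; rewrite /H /= tbE.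
Qed.

HB.instance Definition _ := Measure_isSigmaFinite.Build _ _ _ cons_measure
  cons_measure_sigma_finite.

End cons_measure.

(* k-dimensional Lebesgue measure: the k-fold product of the one-dimensional
   one, transported from nested pairs to tuples; see lebesgue_tuple_box. *)
Fixpoint lebesgue_tuple (R : realType) (k : nat) :
    {sigma_finite_measure set (k.-tuple (measurableTypeR R)) -> \bar R} :=
  match k with
  | 0 => dirac ([tuple] : 0.-tuple (measurableTypeR R))
  | k'.+1 => cons_measure (lebesgue_tuple R k')
  end.

Lemma lebesgue_tupleS (R : realType) (k : nat)
    (A : set (k.+1.-tuple (measurableTypeR R))) :
  lebesgue_tuple R k.+1 A =
    (@lebesgue_measure R \x lebesgue_tuple R k)%E (@tcons R k @^-1` A).
Proof. by []. Qed.

Lemma lebesgue_tuple_box (R : realType) (k : nat)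
    (A : 'I_k -> set (measurableTypeR R)) :
  (forall i, measurable (A i)) ->
  lebesgue_tuple R k [set u | forall i, A i (tnth u i)] =
    (\prod_(i < k) @lebesgue_measure R (A i))%E.
Proof.
elim: k A => [|k IHk] A mA.
  by rewrite big_ord0 /= diracE mem_set//= => -[].
rewrite lebesgue_tupleS big_ord_recl -IHk; last by move=> i; exact: mA.
rewrite -product_measure1E//; last first.
  rewrite (_ : [set u | _] = \bigcap_(i in [set: 'I_k])
      (fun u : k.-tuple (measurableTypeR R) => tnth u i) @^-1` A (lift ord0 i)).
    apply: fin_bigcap_measurable; first exact: finite_finset.
    by move=> i _; rewrite -[X in measurable X]setTI; exact: measurable_tnth.
  by apply/seteqP; split=> u /= Au i; [move=> _; exact: Au|exact: Au].
congr (product_measure1 _ _ _); apply/seteqP; split=> -[x u] /=.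
  move=> Au; split; first exact: (Au ord0).
  by move=> i; have := Au (lift ord0 i); rewrite /tcons tnthS.
move=> [Ax Au] i; have [j ->|->//] := unliftP ord0 i.
by rewrite /tcons tnthS.
Qed.

Definition unit_cube (R : realType) (k : nat) :
    set (k.-tuple (measurableTypeR R)) :=
  [set u | forall i : 'I_k, 0 <= (tnth u i : R) <= 1].
Arguments unit_cube : clear implicits.

Fixpoint double_factorial (m : nat) : nat :=
  if m is m'.+2 then (m * double_factorial m')%N else 1%N.

(* The coordinate u_j of the integral is [tnth u] at index j - 1.  At the corner
   (1, ..., 1), the only point of the cube where the denominator vanishes, the
   integrand takes the value 0 because 0^-1 = 0; that point is negligible. *)
Definition J (R : realType) (k n : nat) : R :=
  match k with
  | 0 => 0
  | 1 => (2 ^ n * n`!)%N%:R / (double_factorial (2 * n + 1))%:R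
  | _ => \sum_(1 <= r < k) 2 ^+ k *
      (\int[lebesgue_tuple R k]_(u in unit_cube R k)
        ((1 - \prod_(i < k | (i < r)%N) (tnth u i : R) ^+ 4) ^+ n
         * (1 - \prod_(i < k | (r <= i)%N) (tnth u i : R) ^+ 4) ^+ n
         / (1 - \prod_(i < k) (tnth u i : R) ^+ 2) ^+ (2 * n + 1)))
  end.

(* Main.v *)
(* Writing L_j(t) = (-ln t)^j / j!, the product of r independent uniform variables
   on [0,1] has density L_(r-1), so summing over r with the binomial theorem gives
   J_k(n) = 2^k \int\int L_(k-2)(x y) F_n(x, y) dx dy on the unit square.
   The substitutions t = x y and then v = (t^2/x^2 - x^2) / (1 - t^2) turn this into
     J_k(n) = 2^(k-1) \int_0^1 L_(k-2)(t) \int_(-1)^1 (1 - v^2)^n / sqrt Q dv dt,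
   with Q = v^2 (1 - t^2)^2 + 4 t^2.  The function tau = t / sqrt Q satisfies
     (t d/dt)^2 tau = v^2(1-v^2) tau_vv + (v - 3v^3) tau_v - v^2 tau.
   Integrating by parts in v, the adjoint of the right-hand operator sends
   (1-v^2)^(n-1) to the combination 4n^2 (1-v^2)^n - (8n^2-8n+3) (1-v^2)^(n-1)
   + 4(n-1)^2 (1-v^2)^(n-2) of the recurrence; integrating by parts in t, two
   derivatives lower L_(k-2) to L_(k-4).  The boundary term at t = 1 survives only
   for k = 3, where it is the beta integral giving J_1(n-1). *)
Require Import Defs.
From mathcomp Require Import all_boot all_order all_algebra.
From mathcomp Require Import all_classical all_reals all_analysis.
From mathcomp Require Import measurable_realfun ring lra.

Set Implicit Arguments.
Unset Strict Implicit.
Unset Printing Implicit Defensive.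

Import Order.TTheory GRing.Theory Num.Theory.
Import numFieldNormedType.Exports.

Local Open Scope classical_set_scope.
Local Open Scope ring_scope.

(** * Iterated integrals and scaling *)

(** The difficulty sits at t = 0, where 1 / sqrt Q has a peak of width about t around v = 0 and the
    logarithms blow up. Both integrations by parts are therefore carried out for t in [e, 1], where
    the integrand in (t, v) is bounded and Fubini applies, and e tends to 0 afterwards. The limit
    rests on a budget of exponents: a power of the logarithm costs t^(-1/4), the v-integral of [tau]
    gains t^(1/2), and the surplus t^(1/4) removes the boundary term at e and makes the moments
    converge. The passage from the cube to the moments works with nonnegative extended-real
    integrals, so that Tonelli asks for no integrability; finiteness of the integrals in [J] is
    deduced at the end from the finite moment. *)

Section iterated_integrals.
Local Open Scope ereal_scope.
Context {d1 d2 : measure_display} {T1 : measurableType d1}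
  {T2 : measurableType d2} {R : realType}.
Context (m1 : {sigma_finite_measure set T1 -> \bar R})
  (m2 : {sigma_finite_measure set T2 -> \bar R}).
Context (A : set T1) (B : set T2) (mA : measurable A) (mB : measurable B).

Let patch_prod (f : T1 * T2 -> \bar R) x :
  \int[m2]_y (f \_ (A `*` B)) (x, y) =
  ((fun x => \int[m2]_(y in B) f (x, y)) \_ A) x.
Proof.
rewrite /patch; case: ifPn => [xA|xA].
  rewrite [RHS]integral_mkcond; apply: eq_integral => y _.
  by rewrite /patch in_setX/= xA.
rewrite integral0_eq// => y _.
by rewrite in_setX/= (negbTE xA).
Qed.

Let patch_prod' (f : T1 * T2 -> \bar R) y :
  \int[m1]_x (f \_ (A `*` B)) (x, y) =
  ((fun y => \int[m1]_(x in A) f (x, y)) \_ B) y.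
Proof.
rewrite /patch; case: ifPn => [yB|yB].
  rewrite [RHS]integral_mkcond; apply: eq_integral => x _.
  by rewrite /patch in_setX/= yB andbT.
rewrite integral0_eq// => x _.
by rewrite in_setX/= (negbTE yB) andbF.
Qed.

Lemma measurable_patchT {d : measure_display} {T : measurableType d}
    (D : set T) (f : T -> \bar R) : measurable D ->
  measurable_fun setT f -> measurable_fun setT (f \_ D).
Proof.
move=> mD mf; apply/(measurable_restrictT f) => //.
exact: measurable_funTS.
Qed.

Context (f : T1 * T2 -> \bar R) (mf : measurable_fun setT f).

Let mpf : measurable_fun setT (f \_ (A `*` B)).
Proof. by apply: measurable_patchT => //; exact: measurableX. Qed.

Section tonelli.
Hypothesis f0 : forall x y, A x -> B y -> 0 <= f (x, y).

Let pf0 z : 0 <= (f \_ (A `*` B)) z.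
Proof. by apply: erestrict_ge0 => -[x y] [/= ? ?]; exact: f0. Qed.

Lemma measurable_integral_in :
  measurable_fun A (fun x => \int[m2]_(y in B) f (x, y)).
Proof.
apply/(measurable_restrictT _ mA).
have := measurable_fun_fubini_tonelli_F (m2 := m2) _ mpf pf0.
by apply: eq_measurable_fun => x _; rewrite /fubini_F patch_prod.
Qed.

Lemma integral_product_in :
  \int[m1 \x m2]_(z in A `*` B) f z =
  \int[m1]_(x in A) \int[m2]_(y in B) f (x, y).
Proof.
rewrite integral_mkcond fubini_tonelli1// [RHS]integral_mkcond.
by apply: eq_integral => x _; rewrite /fubini_F patch_prod.
Qed.

Lemma tonelli_in :
  \int[m1]_(x in A) \int[m2]_(y in B) f (x, y) =
  \int[m2]_(y in B) \int[m1]_(x in A) f (x, y).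
Proof.
rewrite [LHS]integral_mkcond [RHS]integral_mkcond.
under eq_integral do rewrite -patch_prod.
by rewrite fubini_tonelli//; apply: eq_integral => y _; rewrite patch_prod'.
Qed.

End tonelli.

(** Meant for [boundary_derivative], which need not keep a constant sign, so that Tonelli does not
    apply to it. A bound on a rectangle of finite measure yields integrability. *)
Lemma bounded_fubini_in (M : R) : (0 <= M)%R -> m1 A < +oo -> m2 B < +oo ->
  (forall x y, A x -> B y -> `|f (x, y)| <= M%:E) ->
  \int[m1]_(x in A) \int[m2]_(y in B) f (x, y) =
  \int[m2]_(y in B) \int[m1]_(x in A) f (x, y).
Proof.
move=> M0 Afin Bfin fM.
rewrite [LHS]integral_mkcond [RHS]integral_mkcond.
under eq_integral do rewrite -patch_prod.
rewrite Fubini; first by apply: eq_integral => y _; rewrite patch_prod'.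
apply/integrableP; split => //.
rewrite (eq_integral ((abse \o f) \_ (A `*` B))); last first.
  by move=> z _; rewrite restrict_abse.
rewrite -integral_mkcond; apply: le_lt_trans.
  apply: (integral_le_bound (mu := (m1 \x m2)%E) M%:E).
  - exact: measurableX.
  - by apply/measurable_funTS; apply: measurableT_comp.
  - by rewrite lee_fin.
  - by apply: aeW => -[x y] [/= Ax By]; exact: fM.
rewrite lte_mul_pinfty ?lee_fin//= product_measure1E//.
by rewrite lte_mul_pinfty// ge0_fin_numE.
Qed.

End iterated_integrals.

Section measurability.
Context {d : measure_display} {T : measurableType d} {R : realType}.
Implicit Types (D : set T) (f g : T -> R).

Lemma inv_measurable : measurable_fun [set: R] (@GRing.inv R).
Proof.
(* [powR] with exponent -1 is the inverse on nonnegative reals, whence the square; at x = 0 both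
   sides are 0. *)
rewrite (_ : GRing.inv = fun x : R => x * (x ^+ 2) `^ (-1)).
  apply: measurable_funM => //.
  apply: (@measurableT_comp _ _ _ _ _ _ (@powR R ^~ (-1))).
    exact: measurable_powR.
  exact: exprn_measurable.
apply/funext => x; rewrite powR_inv1 ?sqr_ge0// expr2 invfM mulrA.
by have [->|x0] := eqVneq x 0; rewrite ?invr0 ?mulr0// divff// mul1r.
Qed.

Lemma measurable_funV D f : measurable_fun D f ->
  measurable_fun D (fun x => (f x)^-1).
Proof. exact: (measurableT_comp inv_measurable). Qed.

Lemma sqrt_measurable : measurable_fun [set: R] (@Num.sqrt R).
Proof.
by apply: continuous_measurable_fun => x; exact: sqrt_continuous.
Qed.

End measurability.

Section scaling.
Local Open Scope ereal_scope.
Context {R : realType}.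
Local Notation mu := (@lebesgue_measure R).

(** Lebesgue measure is [c] times its pushforward under multiplication by [c]: the two agree on
    half-open intervals, hence everywhere by uniqueness. *)
Lemma integral_scale (c : R) (f : R -> \bar R) : (0 < c)%R ->
  measurable_fun setT f -> (forall x, 0 <= f x) ->
  \int[mu]_x f (c * x)%R = c^-1%:E * \int[mu]_x f x.
Proof.
move=> c0 mf f0.
pose h (x : measurableTypeR R) : measurableTypeR R := (c * x)%R.
have mh : measurable_fun setT h by exact: mulrl_measurable.
pose k : {nonneg R} := NngNum (ltW c0).
pose pf : {measure set (measurableTypeR R) -> \bar R} :=
  measure_function_pushforward__canonical__measure_function_Measure mu mh.
pose nu : {measure set (measurableTypeR R) -> \bar R} := mscale k pf.
have munu A : measurable A -> mu A = nu A.
  apply: lebesgue_measure_unique => _ [[a b] _ <-].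
  rewrite /nu /= /mscale /= /pushforward.
  rewrite (_ : h @^-1` _ = `](a / c)%R, (b / c)%R]%classic); last first.
    apply/seteqP; split=> x /=; rewrite !in_itv/= /h.
      by rewrite ltr_pdivrMr// ler_pdivlMr// mulrC.
    by rewrite ltr_pdivrMr// ler_pdivlMr// mulrC.
  rewrite !lebesgue_measure_itv/= !lte_fin ltr_pM2r ?invr_gt0//.
  case: ifPn => _; last by rewrite mule0.
  by rewrite -!EFinB -EFinM -mulrBl mulrC divfK// gt_eqF.
rewrite [in RHS](eq_measure_integral nu); last by move=> A mA _; exact: munu.
rewrite /nu ge0_integral_mscale// muleA -EFinM mulVf ?gt_eqF// mul1e.
by rewrite ge0_integral_pushforward.
Qed.

End scaling.

(** * Derivatives of the kernel *)

Section derivative_rules.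
Context {R : realType}.
Implicit Types (f g : R -> R) (x df dg : R).

Lemma is_derive1_cst (c x : R) : is_derive x 1 (fun=> c) 0.
Proof. exact: is_derive_cst. Qed.

Lemma is_derive1_id x : is_derive x 1 (fun y : R => y) 1.
Proof. exact: is_derive_id. Qed.

Lemma is_derive1D f g x df dg : is_derive x 1 f df -> is_derive x 1 g dg ->
  is_derive x 1 (fun y => f y + g y) (df + dg).
Proof. by move=> hf hg; exact: is_deriveD. Qed.

Lemma is_derive1N f x df : is_derive x 1 f df ->
  is_derive x 1 (fun y => - f y) (- df).
Proof. by move=> hf; exact: is_deriveN. Qed.

Lemma is_derive1M f g x df dg : is_derive x 1 f df -> is_derive x 1 g dg ->
  is_derive x 1 (fun y => f y * g y) (df * g x + f x * dg).
Proof.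
move=> hf hg; apply: (is_derive_eq (is_deriveM hf hg)).
by rewrite addrC [g x *: _]mulrC.
Qed.

Lemma is_derive1X f n x df : is_derive x 1 f df ->
  is_derive x 1 (fun y => f y ^+ n) (n%:R * f x ^+ n.-1 * df).
Proof.
move=> hf; rewrite (_ : (fun y => f y ^+ n) = f ^+ n).
  exact: is_deriveX.
by rewrite exprfctE.
Qed.

Lemma is_derive1V f x df : f x != 0 -> is_derive x 1 f df ->
  is_derive x 1 (fun y => (f y)^-1) (- (f x ^- 2 * df)).
Proof.
move=> fx0 hf; apply: (is_derive_eq (is_deriveV fx0 hf)).
by rewrite /GRing.scale/= mulNr.
Qed.

Lemma is_derive1_compose (h : R -> R) f x df dh :
  is_derive (f x) 1 h dh -> is_derive x 1 f df ->
  is_derive x 1 (fun y => h (f y)) (dh * df).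
Proof. by move=> ? ?; exact: (is_derive1_comp (f := h)). Qed.

Lemma is_derive1_continuous f x df : is_derive x 1 f df ->
  {for x, continuous f}.
Proof.
by move=> [/derivable1_diffP hf _]; exact: differentiable_continuous.
Qed.

(** Continuity of the integrand is replaced by derivability because the latter is what
    [derive_rules] establishes; two-sided derivatives at the end points come for free since the
    kernel is smooth for t > 0. *)
Lemma FTC_derivable f F (a b : R) : a < b ->
  (forall x, a <= x <= b -> is_derive x 1 F (f x)) ->
  (forall x, a <= x <= b -> derivable f x 1) ->
  (\int[lebesgue_measure]_(x in `[a, b]) (f x)%:E = (F b - F a)%:E)%E.
Proof.
move=> ab dF df.
have cont (g : R -> R) x : derivable g x 1 -> {for x, continuous g}.
  by move=> /derivable1_diffP hg; exact: differentiable_continuous.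
rewrite (@continuous_FTC2 _ f F)//.
- apply: continuous_in_subspaceT => x; rewrite inE/= in_itv/= => xab.
  exact/cont/df.
- split.
  + move=> x; rewrite in_itv/= => /andP[ax xb].
    have h : a <= x <= b by rewrite (ltW ax) (ltW xb).
    by have [] := dF x h.
  + apply: cvg_at_right_filter; apply: cont.
    have h : a <= a <= b by rewrite lexx (ltW ab).
    by have [] := dF a h.
  + apply: cvg_at_left_filter; apply: cont.
    have h : a <= b <= b by rewrite lexx (ltW ab).
    by have [] := dF b h.
- move=> x; rewrite in_itv/= => /andP[ax xb].
  rewrite derive1E; have h : a <= x <= b by rewrite (ltW ax) (ltW xb).
  by have [] := dF x h.
Qed.

End derivative_rules.

(* Class resolution would instantiate the derivative by ['D_1 f x] instead of
   leaving it to be computed, hence [notypeclasses]. *)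
Ltac derive_rules :=
  repeat first
    [ eassumption
    | notypeclasses refine (is_derive1_cst _ _)
    | notypeclasses refine (is_derive1_id _)
    | notypeclasses refine (is_derive1X _ _)
    | notypeclasses refine (is_derive1D _ _)
    | notypeclasses refine (is_derive1N _)
    | notypeclasses refine (is_derive1M _ _) ].

Section kernel.
Context {R : realType}.
Implicit Types (v t : R).

Definition quad v t : R := v ^+ 2 * (1 - t ^+ 2) ^+ 2 + 4 * t ^+ 2.
Definition rquad v t : R := (Num.sqrt (quad v t))^-1.
Definition tau v t : R := t * rquad v t.
(* [tau1] and [tau2] are the first two iterates of -t d/dt on [tau]. *)
Definition tau1 v t : R := - (t * v ^+ 2 * (1 - t ^+ 4) * rquad v t ^+ 3).
Definition tau2 v t : R :=
  v ^+ 2 * t * ((1 - 5 * t ^+ 4) * rquad v t ^+ 3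
    - 3 / 2 * (t - t ^+ 5) * (8 * t - 4 * v ^+ 2 * t * (1 - t ^+ 2))
      * rquad v t ^+ 5).

Lemma quad_gt0 v t : 0 < t -> 0 < quad v t.
Proof.
move=> t0; rewrite /quad ltr_wpDl//.
  by rewrite mulr_ge0// sqr_ge0.
by rewrite mulr_gt0// exprn_gt0.
Qed.

Lemma rquad_gt0 v t : 0 < t -> 0 < rquad v t.
Proof. by move=> t0; rewrite /rquad invr_gt0 sqrtr_gt0 quad_gt0. Qed.

(** Eliminates the square root from the differential identities: multiplying by Q r^2 = 1, with r =
    [rquad v t], brings all terms to one power of r and leaves an identity of rational functions for
    [field]. *)
Lemma rquadK v t : 0 < t -> quad v t * rquad v t ^+ 2 = 1.
Proof.
move=> t0; rewrite /rquad exprVn sqr_sqrtr ?(ltW (quad_gt0 _ t0))//.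
by rewrite divff// gt_eqF// quad_gt0.
Qed.

Let is_derive_rsqrt (f : R -> R) (x df : R) : 0 < f x -> is_derive x 1 f df ->
  is_derive x 1 (fun y => (Num.sqrt (f y))^-1)
    (- (df / 2) * (Num.sqrt (f x))^-1 ^+ 3).
Proof.
move=> fx0 hf.
have h := is_derive1_compose (is_derive1_sqrt fx0) hf.
have s0 : Num.sqrt (f x) != 0 by rewrite gt_eqF// sqrtr_gt0.
apply: (is_derive_eq (is_derive1V (f := fun y => Num.sqrt (f y)) s0 h)).
by field.
Qed.

Lemma is_derive_rquad v t : 0 < t -> is_derive t 1 (rquad v)
  (- ((8 * t - 4 * v ^+ 2 * t * (1 - t ^+ 2)) / 2) * rquad v t ^+ 3).
Proof.
move=> t0; apply: is_derive_rsqrt; first exact: quad_gt0.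
rewrite /quad; notypeclasses refine (is_derive_eq _ _); first by derive_rules.
by rewrite /=; ring.
Qed.

Lemma is_derive_rquad_v v t : 0 < t -> is_derive v 1 (rquad ^~ t)
  (- (v * (1 - t ^+ 2) ^+ 2) * rquad v t ^+ 3).
Proof.
move=> t0; notypeclasses refine (is_derive_eq _ _).
  notypeclasses refine (@is_derive_rsqrt (quad ^~ t) _ _ _ _); first exact: quad_gt0.
  by rewrite /quad; derive_rules.
by rewrite -/(rquad v t) /=; field.
Qed.

Lemma is_derive_tau v t : 0 < t -> is_derive t 1 (tau v) (- (tau1 v t / t)).
Proof.
move=> t0; have h := is_derive_rquad v t0.
rewrite /tau; notypeclasses refine (is_derive_eq _ _); first by derive_rules.
have e : rquad v t = quad v t * rquad v t ^+ 3.
  by rewrite exprS mulrCA rquadK// mulr1.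
rewrite /tau1 [X in 1 * X]e /quad.
by field; rewrite gt_eqF.
Qed.

Lemma is_derive_tau1 v t : 0 < t -> is_derive t 1 (tau1 v) (- (tau2 v t / t)).
Proof.
move=> t0; have h := is_derive_rquad v t0.
rewrite /tau1; notypeclasses refine (is_derive_eq _ _); first by derive_rules.
by rewrite /tau2 /=; field; rewrite gt_eqF.
Qed.

Lemma derivable_tau2 v t : 0 < t -> derivable (tau2 v) t 1.
Proof.
move=> t0; have h := is_derive_rquad v t0.
suff [d []] : exists d, is_derive t 1 (tau2 v) d by [].
by eexists; rewrite /tau2; derive_rules.
Qed.

(* Lagrange's identity for the operator M = v^2(1-v^2) d_v^2 + (v-3v^3) d_v - v^2,
   which satisfies M tau = tau2, and the weight w = (1-v^2)^(m+1): this is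
   v^2(1-v^2) w tau_v - (v^2(1-v^2) w)_v tau + (v-3v^3) w tau. *)
Definition concomitant (m : nat) t v : R :=
  let p := 1 - v ^+ 2 in
  - (v ^+ 3 * p ^+ m.+2 * t * (1 - t ^+ 2) ^+ 2 * rquad v t ^+ 3)
  + ((v - 3 * v ^+ 3) * p ^+ m.+1 - 2 * v * p ^+ m.+2
     + 2 * m.+2%:R * v ^+ 3 * p ^+ m.+1) * tau v t.

(** The formal adjoint of M applied to p^(m+1), where p = 1 - v^2. Three neighbouring powers appear
    because v^2 = 1 - p and (p^k)'' = 4k(k-1) p^(k-2) - 2k(2k-1) p^(k-1). Taking n = m + 2 avoids
    truncated subtraction in the exponents. *)
Definition adjoint_weight (m : nat) v : R :=
  let p := 1 - v ^+ 2 in let n := m.+2%:R in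
  4 * n ^+ 2 * p ^+ m.+2 - (8 * n ^+ 2 - 8 * n + 3) * p ^+ m.+1
  + 4 * (n - 1) ^+ 2 * p ^+ m.

Lemma is_derive_concomitant m t v : 0 < t ->
  is_derive v 1 (concomitant m t)
    ((1 - v ^+ 2) ^+ m.+1 * tau2 v t - adjoint_weight m v * tau v t).
Proof.
move=> t0; have h := is_derive_rquad_v v t0.
rewrite /concomitant /tau; notypeclasses refine (is_derive_eq _ _); first by derive_rules.
(* Differentiating r^3 produces r^5, so r^3 and r are raised to the fifth power as well. *)
have e3 : rquad v t ^+ 3 = quad v t * rquad v t ^+ 5.
  by rewrite -[LHS]mul1r -(rquadK v t0); ring.
have e1 : rquad v t = quad v t ^+ 2 * rquad v t ^+ 5.
  by rewrite expr2 -mulrA -e3 exprS mulrCA rquadK// mulr1.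
rewrite /tau2 /tau /adjoint_weight /=.
set r := rquad v t in e1 e3 *.
(* The fifth power arises as r^2 times r^3; it is merged first, so that rewriting with [e3] does not
   break it up. *)
have e5 a b : a * r ^+ 2 * (b * r ^+ 3) = a * b * r ^+ 5 by ring.
rewrite e5; set r5 := r ^+ 5 in e1 e3 *.
rewrite !e3 !e1.
rewrite ![(1 - _) ^+ m.+2]exprSr ![(1 - _) ^+ m.+1]exprSr.
set P := (_ ^+ m).
by rewrite /quad; field.
Qed.

Lemma derivable_concomitant_derivative m t v : 0 < t ->
  derivable (fun v => (1 - v ^+ 2) ^+ m.+1 * tau2 v t
                      - adjoint_weight m v * tau v t) v 1.
Proof.
move=> t0; have h := is_derive_rquad_v v t0.
suff [d []] : exists d, is_derive v 1 (fun v => (1 - v ^+ 2) ^+ m.+1 * tau2 v t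
                      - adjoint_weight m v * tau v t) d by [].
by eexists; rewrite /tau2 /tau /adjoint_weight; derive_rules.
Qed.

End kernel.

(** * Closure rules for measurability and boundedness *)

Section measurable_rules.
Context {d : measure_display} {T : measurableType d} {R : realType}.
Implicit Types (D : set T) (f g : T -> R).

Lemma measurable_add D f g : measurable_fun D f -> measurable_fun D g ->
  measurable_fun D (fun x => f x + g x).
Proof. by move=> ? ?; exact: measurable_funD. Qed.

Lemma measurable_mul D f g : measurable_fun D f -> measurable_fun D g ->
  measurable_fun D (fun x => f x * g x).
Proof. by move=> ? ?; exact: measurable_funM. Qed.

Lemma measurable_opp D f : measurable_fun D f ->
  measurable_fun D (fun x => - f x).
Proof. by move=> ?; exact: measurable_funN. Qed.

Lemma measurable_exp D f n : measurable_fun D f ->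
  measurable_fun D (fun x => f x ^+ n).
Proof. by move=> ?; exact: measurable_funX. Qed.

Lemma measurable_sqrt D f : measurable_fun D f ->
  measurable_fun D (fun x => Num.sqrt (f x)).
Proof. exact: (measurableT_comp sqrt_measurable). Qed.

Lemma measurable_log D f : measurable_fun D f ->
  measurable_fun D (fun x => ln (f x)).
Proof. exact: (measurableT_comp (@measurable_ln R)). Qed.

End measurable_rules.

Ltac measurable_rules :=
  repeat first
    [ eassumption
    | apply: measurable_cst | apply: measurable_fst | apply: measurable_snd
    | apply: measurable_id
    | apply: measurable_exp | apply: measurable_add | apply: measurable_opp
    | apply: measurable_mul | apply: measurable_funV | apply: measurable_sqrt
    | apply: measurable_log ].

Section bounded_rules.
Context {R : realType} (A B : set R).
Implicit Types f g : R -> R -> R.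

Definition bounded_on f :=
  exists2 M : R, 0 <= M & forall x y, A x -> B y -> `|f x y| <= M.

Lemma bounded_on_cst (c : R) : bounded_on (fun _ _ => c).
Proof. by exists `|c|. Qed.

Lemma bounded_on_add f g : bounded_on f -> bounded_on g ->
  bounded_on (fun x y => f x y + g x y).
Proof.
move=> [M M0 fM] [N N0 gN]; exists (M + N); first exact: addr_ge0.
by move=> x y Ax By; rewrite (le_trans (ler_normD _ _))// lerD ?fM ?gN.
Qed.

Lemma bounded_on_mul f g : bounded_on f -> bounded_on g ->
  bounded_on (fun x y => f x y * g x y).
Proof.
move=> [M M0 fM] [N N0 gN]; exists (M * N); first exact: mulr_ge0.
by move=> x y Ax By; rewrite normrM ler_pM ?fM ?gN.
Qed.

Lemma bounded_on_opp f : bounded_on f -> bounded_on (fun x y => - f x y).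
Proof. by move=> [M M0 fM]; exists M => // x y Ax By; rewrite normrN fM. Qed.

Lemma bounded_on_exp f n : bounded_on f -> bounded_on (fun x y => f x y ^+ n).
Proof.
move=> [M M0 fM]; exists (M ^+ n); first exact: exprn_ge0.
by move=> x y Ax By; rewrite normrX lerXn2r ?nnegrE// fM.
Qed.

End bounded_rules.

Ltac bounded_rules :=
  repeat first
    [ eassumption
    | apply: bounded_on_cst | apply: bounded_on_exp | apply: bounded_on_add
    | apply: bounded_on_opp | apply: bounded_on_mul ].

(** * Powers of the logarithm and their growth near t = 0 *)

Section log_powers.
Context {R : realType}.
Implicit Types t : R.

Definition lpow (j : nat) t : R := (- ln t) ^+ j / j`!%:R.

(** L_(j-i) with L_k = 0 for k < 0. Truncated subtraction alone would give L_0 = 1 there, and t d/dt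
    L_k = - L_(k-1) would fail at k = 0. *)
Definition lpowB (j i : nat) t : R := if (i <= j)%N then lpow (j - i) t else 0.

Lemma lpowB0 j : lpowB j 0 = lpow j.
Proof. by rewrite /lpowB leq0n subn0. Qed.

Lemma lpowBE j i : lpowB j i = if (i <= j)%N then lpow (j - i) else cst 0.
Proof. by apply/funext => t; rewrite /lpowB; case: ifPn. Qed.

Lemma is_derive_lpowB j i t : 0 < t ->
  is_derive t 1 (lpowB j i) (- (lpowB j i.+1 t / t)).
Proof.
move=> t0; have h := is_derive1_ln t0.
rewrite /lpowB; have [ij|ji|->] := ltngtP i j.
- rewrite (_ : j - i = (j - i.+1).+1)%N; last by rewrite subnSK.
  set k := (j - i.+1)%N; rewrite /lpow.
  notypeclasses refine (is_derive_eq _ _); first by derive_rules.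
  rewrite /= factS natrM; field.
  by rewrite pnatr_eq0 -lt0n fact_gt0 (gt_eqF t0) addrC natr1 pnatr_eq0.
- rewrite mul0r oppr0; exact: is_derive1_cst.
- rewrite subnn mul0r oppr0 /lpow.
  under eq_fun do rewrite expr0.
  exact: is_derive1_cst.
Qed.

Lemma lpow_ge0 j t : 0 < t <= 1 -> 0 <= lpow j t.
Proof.
move=> /andP[t0 t1]; rewrite /lpow divr_ge0// exprn_ge0//.
by rewrite oppr_ge0 ln_le0.
Qed.

Lemma lpowB_ge0 j i t : 0 < t <= 1 -> 0 <= lpowB j i t.
Proof. by rewrite /lpowB; case: ifPn => // _; exact: lpow_ge0. Qed.

Lemma lpow1 j : lpow j 1 = (j == 0)%:R.
Proof.
by rewrite /lpow ln1 oppr0 expr0n; case: eqP => [->|_]; rewrite ?mul0r// divr1.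
Qed.

(** The fourth root of t, through which all decay at 0 is measured: it absorbs the logarithms
    ([lpow_le]), its square is gained by integrating [tau] in v ([kerint0_le]), and what remains of
    the two tends to 0 and stays integrable after division by t. *)
Definition root4 t : R := expR (ln t / 4).

Lemma root4_gt0 t : 0 < root4 t. Proof. exact: expR_gt0. Qed.

Lemma root4_expr4 t : 0 < t -> root4 t ^+ 4 = t.
Proof.
move=> t0; rewrite /root4 -expRM_natl -[RHS]lnK ?posrE//.
by congr expR; field.
Qed.

(** With s = - ln t / 4 this is 4^j times the inequality s^j / j! <= exp s. *)
Lemma lpow_le j t : 0 < t <= 1 -> lpow j t <= 4 ^+ j / root4 t.
Proof.
move=> /andP[t0 t1]; rewrite /root4 -expRN.
have s0 : 0 <= - ln t / 4 by rewrite divr_ge0// oppr_ge0 ln_le0.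
have : (- ln t / 4) ^+ j / j`!%:R <= expR (- ln t / 4).
  case: j => [|j]; first by rewrite expr0 fact0 divr1 -[leLHS]expR0 ler_expR.
  by apply: le_trans (expR_ge1Dxn j s0); rewrite lerDr.
rewrite -(ler_pM2l (x := 4 ^+ j)) ?exprn_gt0// mulNr; apply: le_trans.
by rewrite /lpow mulrA -exprMn -mulNr mulrCA divff ?mulr1.
Qed.

Lemma lpowB_le j i t : 0 < t <= 1 -> lpowB j i t <= 4 ^+ j / root4 t.
Proof.
move=> t01; rewrite /lpowB; case: ifPn => ij.
  apply: le_trans (lpow_le _ t01) _; rewrite ler_pM2r ?invr_gt0 ?root4_gt0//.
  by rewrite ler_eXn2l ?leq_subr// ltr1n.
by rewrite divr_ge0// ?exprn_ge0// ltW// root4_gt0.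
Qed.

Lemma is_derive_root4 t : 0 < t -> is_derive t 1 root4 (root4 t / (4 * t)).
Proof.
move=> t0; have h := is_derive1_ln t0.
have h4 : is_derive t 1 (fun t => ln t / 4) (t^-1 / 4).
  by notypeclasses refine (is_derive_eq _ _); [derive_rules|rewrite mulr0 addr0].
apply: (is_derive_eq (is_derive1_compose (h := expR)
  (f := fun t => ln t / 4) (is_derive_expR _) h4)).
by rewrite /root4; field; rewrite gt_eqF.
Qed.

End log_powers.

Section kernel_bounds.
Context {R : realType}.
Implicit Types v t : R.
Local Notation mu := (@lebesgue_measure R).

Lemma sqr_le1 v : -1 <= v <= 1 -> v ^+ 2 <= 1.
Proof. by move=> ?; nra. Qed.

Lemma quad_ge v t : -1 <= v <= 1 -> 0 < t <= 1 ->
  (v ^+ 2 + t ^+ 2) / 2 <= quad v t.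
Proof.
move=> /sqr_le1 v1 /andP[t0 t1]; rewrite /quad.
have := sqr_ge0 v; have := sqr_ge0 t; set a := t ^+ 2; set b := v ^+ 2 in v1 *.
by nra.
Qed.

Lemma tau_ge0 v t : 0 < t -> 0 <= tau v t.
Proof. by move=> t0; rewrite /tau mulr_ge0// ltW// rquad_gt0. Qed.

(* AM-GM: 2 r <= q^2 r^2 + q^-2 with r = rquad v t and q^4 = t *)
Lemma tau_le v t : -1 <= v <= 1 -> 0 < t <= 1 ->
  tau v t <= root4 t ^+ 2 * (t / (t ^+ 2 + v ^+ 2) + 1 / 2).
Proof.
move=> v1 t01; have /andP[t0 t1] := t01.
have q0 := root4_gt0 t; have tq := root4_expr4 t0.
set q := root4 t in q0 tq *.
have s0 : 0 < t ^+ 2 + v ^+ 2 by rewrite ltr_pwDl ?exprn_gt0// sqr_ge0.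
have r2 : rquad v t ^+ 2 <= 2 / (t ^+ 2 + v ^+ 2).
  have -> : rquad v t ^+ 2 = (quad v t)^-1.
    apply: (mulfI (lt0r_neq0 (quad_gt0 v t0))).
    by rewrite rquadK// divff// lt0r_neq0// quad_gt0.
  rewrite -invf_div lef_pV2 ?posrE ?divr_gt0 ?quad_gt0//.
  by rewrite addrC; exact: quad_ge.
apply: (@le_trans _ _ (q ^+ 2 * (t * rquad v t ^+ 2 / 2 + 1 / 2))).
  rewrite /tau -subr_ge0; set r := rquad v t.
  (* The summand with factor t - q^4 is zero; it makes the completed square an identity in
     independent t, q and r, which [field] can check. *)
  rewrite (_ : _ - _ = q ^+ 2 / 2 * (q ^+ 2 * r - 1) ^+ 2
    + (t - q ^+ 4) * (q ^+ 2 * r ^+ 2 / 2 - r)); last by field.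
  rewrite tq subrr mul0r addr0.
  by rewrite mulr_ge0 ?sqr_ge0// divr_ge0 ?sqr_ge0.
rewrite ler_pM2l ?exprn_gt0// lerD2r -mulrA ler_pM2l//.
by rewrite ler_pdivrMr// mulrC.
Qed.

(** Inserting Q r^2 = 1 and cancelling t r^3 reduces the bound to v^2 (1 - t^4) <= 2 Q, a polynomial
    inequality in t^2 and v^2. *)
Lemma tau1_le v t : -1 <= v <= 1 -> 0 < t <= 1 -> `|tau1 v t| <= 2 * tau v t.
Proof.
move=> /sqr_le1 v1 /andP[t0 t1].
have r0 := rquad_gt0 v t0.
rewrite /tau1 normrN ger0_norm; last first.
  have t4 : 0 <= 1 - t ^+ 4 by rewrite subr_ge0 exprn_ile1// ltW.
  apply: mulr_ge0; last by rewrite exprn_ge0// ltW.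
  by apply: mulr_ge0 => //; apply: mulr_ge0; rewrite ?sqr_ge0// ltW.
have -> : 2 * tau v t = t * rquad v t * (2 * (quad v t * rquad v t ^+ 2)).
  by rewrite rquadK// /tau; ring.
have -> : t * v ^+ 2 * (1 - t ^+ 4) * rquad v t ^+ 3 =
  t * rquad v t * (v ^+ 2 * (1 - t ^+ 4) * rquad v t ^+ 2) by ring.
rewrite ler_pM2l ?mulr_gt0// mulrA ler_pM2r ?exprn_gt0// /quad.
have -> : t ^+ 4 = (t ^+ 2) ^+ 2 by ring.
have a0 := sqr_ge0 t.
have a1 : t ^+ 2 <= 1 by rewrite exprn_ile1// ltW.
move: a0 a1 v1 (sqr_ge0 v); move: (t ^+ 2) (v ^+ 2) => a b a0 a1 b1 b0.
have : 0 <= b * (1 - a) * (1 - a) by rewrite !mulr_ge0 ?subr_ge0.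
have : b * a <= a by rewrite ler_piMl.
by nra.
Qed.

Lemma integrable_derivable (f : R -> R) a b :
  (forall x, a <= x <= b -> derivable f x 1) ->
  mu.-integrable `[a, b] (EFin \o f).
Proof.
move=> df; apply: continuous_compact_integrable; first exact: segment_compact.
apply: continuous_in_subspaceT => x; rewrite inE/= in_itv/= => xab.
by apply: differentiable_continuous; apply/derivable1_diffP/df.
Qed.

End kernel_bounds.

(** * Moments and their recurrence *)

Section kernel_integral.
Context {R : realType}.
Implicit Types v t : R.
Local Notation mu := (@lebesgue_measure R).

(** The primitive 4 t^(1/4) bounds the integral over each [1/(i+1), 1] by 4, and monotone
    convergence carries the bound to the union of these intervals. *)
Lemma integrable_root4_div :
  mu.-integrable `]0, 1[ (fun t => (root4 t / t)%:E).
Proof.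
have f0 t : 0 < t -> 0 <= root4 t / t.
  by move=> t0; rewrite divr_ge0// ltW// root4_gt0.
have mf : measurable_fun [set: R] (fun t : R => root4 t / t).
  apply: measurable_mul; last exact: inv_measurable.
  apply: (measurableT_comp (@measurable_expR R)).
  by apply: measurable_mul => //; exact: measurable_ln.
apply/integrableP; split; first exact/measurable_EFinP/measurable_funTS.
pose F (i : nat) := `[i.+1%:R^-1 : R, 1]%classic.
have FU : `]0, 1[ `<=` \bigcup_i F i.
  move=> t /=; rewrite in_itv/= => /andP[t0 t1].
  have [n _ /(_ n (leqnn n)) h] := near_infty_natSinv_lt (PosNum t0).
  by exists n => //; rewrite /F/= in_itv/= (ltW t1) ltW.
have Fpos i x : F i x -> 0 < x.
  by rewrite /F/= in_itv/= => /andP[+ _]; apply: lt_le_trans; rewrite invr_gt0.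
apply: (@le_lt_trans _ _ 4%:E); last exact: ltry.
have h : (\int[mu]_(t in F i) (root4 t / t)%:E)%E @[i --> \oo] -->
    (\int[mu]_(t in \bigcup_i F i) (root4 t / t)%:E)%E.
  apply: ge0_nondecreasing_set_cvg_integral => //.
  - apply/nondecreasing_seqP => i; rewrite subsetEset.
    move=> x; rewrite /F/= !in_itv/= => /andP[h ->]; rewrite andbT.
    by rewrite (le_trans _ h)// lef_pV2 ?posrE// ler_nat.
  - by move=> i; rewrite /F.
  - by move=> i; exact/measurable_EFinP/measurable_funTS.
  - by move=> i x /Fpos x0; rewrite lee_fin f0.
apply: (@le_trans _ _ (\int[mu]_(t in \bigcup_i F i) (root4 t / t)%:E)%E).
  under eq_integral => t.
    rewrite inE/= in_itv/= => /andP[t0 _]; rewrite /= ger0_norm ?f0//; over.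
  apply: ge0_subset_integral => //.
  - by apply: bigcup_measurable => i _; rewrite /F.
  - exact/measurable_EFinP/measurable_funTS.
  - by move=> x [i _ /Fpos x0]; rewrite lee_fin f0.
apply: cvge_le h; apply: nearW => -[|i].
  by rewrite /F invr1 set_itv1 integral_set1 lee_fin.
have x0 x : (i.+2%:R^-1 : R) <= x <= 1 -> 0 < x.
  by move=> /andP[ix _]; apply: lt_le_trans ix; rewrite invr_gt0.
have i1 : (i.+2%:R^-1 : R) < 1 by rewrite invf_lt1// ltr1n.
have dF x : (i.+2%:R^-1 : R) <= x <= 1 ->
    is_derive x 1 (fun t => 4 * root4 t) (root4 x / x).
  move=> /x0 {}x0; have h4 := is_derive_root4 x0.
  notypeclasses refine (is_derive_eq _ _); first by derive_rules.
  by field; rewrite gt_eqF.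
rewrite /F (FTC_derivable i1 dF).
  rewrite lee_fin /root4 ln1 mul0r expR0 mulr1 gerBl.
  by rewrite mulr_ge0// expR_ge0.
move=> x /x0 {}x0; have h4 := is_derive_root4 x0.
have h5 := is_derive1V (lt0r_neq0 x0) (is_derive1_id x).
suff [d []] : exists d, is_derive x 1 (fun t => root4 t / t) d by [].
by eexists; derive_rules.
Qed.

Definition kerint (n : nat) t : R :=
  \int[mu]_(v in `[(-1)%R, 1%R]) ((1 - v ^+ 2) ^+ n * rquad v t).

Lemma integrable_kerint n t : 0 < t ->
  mu.-integrable `[-1, 1] (fun v => ((1 - v ^+ 2) ^+ n * rquad v t)%:E).
Proof.
move=> t0; apply: integrable_derivable => v _.
have h := is_derive_rquad_v v t0.
suff [d []] : exists d,
  is_derive v 1 (fun v => (1 - v ^+ 2) ^+ n * rquad v t) d by [].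
by eexists; derive_rules.
Qed.

Lemma integral_kerint n t (c : R) : 0 < t ->
  (\int[mu]_(v in `[(-1)%R, 1%R]) (c * ((1 - v ^+ 2) ^+ n * rquad v t))%:E =
   (c * kerint n t)%:E)%E.
Proof.
move=> t0; rewrite /kerint /Rintegral EFinM fineK; last first.
  by apply: integrable_fin_num => //; exact: integrable_kerint.
by rewrite -integralZl//; exact: integrable_kerint.
Qed.

Lemma onem_sqr_ge0 v : -1 <= v <= 1 -> 0 <= 1 - v ^+ 2.
Proof. by move=> /sqr_le1; rewrite subr_ge0. Qed.

Lemma onem_sqr_le1 v : 1 - v ^+ 2 <= 1.
Proof. by rewrite gerBl sqr_ge0. Qed.

Lemma kerint_ge0 n t : 0 < t -> 0 <= kerint n t.
Proof.
move=> t0; apply: Rintegral_ge0 => v /=; rewrite in_itv/= => v1.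
by rewrite mulr_ge0 ?exprn_ge0 ?onem_sqr_ge0// ltW// rquad_gt0.
Qed.

Lemma kerint_le n t : 0 < t -> kerint n t <= kerint 0 t.
Proof.
move=> t0; apply: le_Rintegral => //; try exact: integrable_kerint.
move=> v /=; rewrite in_itv/= => v1; rewrite ler_pM2r ?rquad_gt0//.
by rewrite expr0 exprn_ile1 ?onem_sqr_ge0 ?onem_sqr_le1.
Qed.

(** Integrates [tau_le] over v: t / (t^2 + v^2) is the derivative of atan (v / t), whose increment
    stays below pi however small t is. *)
Lemma kerint0_le t : 0 < t <= 1 -> t * kerint 0 t <= root4 t ^+ 2 * (pi + 1).
Proof.
move=> t01; have /andP[t0 t1] := t01.
rewrite -lee_fin -integral_kerint//.
pose f v := root4 t ^+ 2 * (t / (t ^+ 2 + v ^+ 2) + 1 / 2).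
have s0 v : 0 < t ^+ 2 + v ^+ 2 by rewrite ltr_pwDl ?exprn_gt0// sqr_ge0.
have hV v : is_derive v 1 (fun v => (t ^+ 2 + v ^+ 2)^-1)
    (- ((t ^+ 2 + v ^+ 2) ^- 2 * (0 + 2%:R * v ^+ 1 * 1))).
  notypeclasses refine (is_derive1V _ _); first by rewrite gt_eqF.
  by derive_rules.
have df v : derivable f v 1.
  have h := hV v.
  suff [d []] : exists d, is_derive v 1 f d by [].
  by eexists; rewrite /f; derive_rules.
apply: (@le_trans _ _ (\int[mu]_(v in `[(-1)%R, 1%R]) (f v)%:E)%E).
  apply: le_integral => //.
  - exact: (integrableZl _ _ (integrable_kerint 0 t0)).
  - by apply: integrable_derivable => v _; exact: df.
  - move=> v; rewrite inE/= in_itv/= => v1.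
    by rewrite lee_fin expr0 mul1r; exact: tau_le.
have dF v : -1 <= v <= 1 -> is_derive v 1
    (fun v => root4 t ^+ 2 * (atan (v / t) + v / 2)) (f v).
  move=> _.
  have ha : is_derive v 1 (fun v => atan (v / t)) ((1 + (v / t) ^+ 2)^-1 * t^-1).
    apply: (is_derive1_compose (h := @atan R) (f := fun v => v / t)).
    notypeclasses refine (is_derive_eq _ _); first by derive_rules.
    by rewrite mul1r mulr0 addr0.
  notypeclasses refine (is_derive_eq _ _); first by derive_rules.
  by rewrite /f; field; rewrite gt_eqF//= gt_eqF//= addrC gt_eqF.
have N11 : (-1 : R) < 1 by lra.
rewrite (FTC_derivable N11 dF) => [|v _]; last exact: df.
rewrite lee_fin -mulrBr ler_pM2l ?exprn_gt0 ?root4_gt0//.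
rewrite !mulNr atanN.
by have := atan_ltpi2 (1 / t); have := @pi_gt0 R; lra.
Qed.

End kernel_integral.

Section moments.
Context {R : realType}.
Implicit Types v t : R.
Local Notation mu := (@lebesgue_measure R).

Lemma integrable_itv_closure (a b : R) (f : R -> \bar R) :
  mu.-integrable `]a, b[ f -> mu.-integrable `[a, b] f.
Proof.
move=> /integrableP[mf fi]; apply/integrableP; split.
  exact: emeasurable_fun_itv_cc mf.
by rewrite integral_itv_bndoo//; exact: measurableT_comp.
Qed.

Lemma measurable_lpow (d : measure_display) (T : measurableType d) (D : set T)
    (f : T -> R) j : measurable_fun D f ->
  measurable_fun D (fun x => lpow j (f x)).
Proof. by move=> mf; rewrite /lpow; measurable_rules. Qed.

Lemma measurable_rquad (d : measure_display) (T : measurableType d) (D : set T)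
    (f g : T -> R) : measurable_fun D f -> measurable_fun D g ->
  measurable_fun D (fun x => rquad (f x) (g x)).
Proof. by move=> mf mg; rewrite /rquad /quad; measurable_rules. Qed.

(** Dominated by a constant times t^(1/4) / t: the logarithms contribute t^(-1/4) and [kerint]
    contributes t^(1/2) / t. *)
Lemma integrable_lpow_kerint j n :
  mu.-integrable `]0, 1[ (fun t => (lpow j t * kerint n t)%:E).
Proof.
have : mu.-integrable `]0, 1[
    (fun t => ((4 ^+ j * (pi + 1))%:E * (root4 t / t)%:E)%E).
  by apply: integrableZl => //; exact: integrable_root4_div.
apply: le_integrable => //; last first.
  move=> t /=; rewrite in_itv/= => /andP[t0 t1].
  have t01 : 0 < t <= 1 by rewrite t0 ltW.
  have q0 := root4_gt0 t.
  rewrite lee_fin ger0_norm; last by rewrite mulr_ge0 ?lpow_ge0 ?kerint_ge0.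
  rewrite ger0_norm; last first.
    apply: mulr_ge0; last by rewrite divr_ge0// ltW.
    by rewrite mulr_ge0 ?exprn_ge0// addr_ge0// ltW// pi_gt0.
  have h : kerint n t <= root4 t ^+ 2 * (pi + 1) / t.
    apply: (le_trans (kerint_le n t0)).
    by rewrite ler_pdivlMr// mulrC; exact: kerint0_le.
  apply: (le_trans (ler_pM (lpow_ge0 j t01) (kerint_ge0 n t0) (lpow_le j t01) h)).
  by rewrite le_eqVlt; apply/orP; left; apply/eqP; field; rewrite !gt_eqF.
(* Measurability in t of the inner integral is read off from Tonelli on the product. *)
pose f (z : measurableTypeR R * measurableTypeR R) :=
  (lpow j z.1 * ((1 - z.2 ^+ 2) ^+ n * rquad z.2 z.1))%:E.
have mf : measurable_fun setT f.
  apply/measurable_EFinP; apply: measurable_mul.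
    by apply: measurable_lpow; measurable_rules.
  apply: measurable_mul; first by measurable_rules.
  by apply: measurable_rquad; measurable_rules.
have := @measurable_integral_in _ _ (measurableTypeR R) (measurableTypeR R) R
  mu `]0%R, 1%R[ `[(-1)%R, 1%R] (measurable_itv _) (measurable_itv _) f mf.
have f0 x y : `]0%R, 1%R[%classic x -> `[(-1)%R, 1%R]%classic y -> (0 <= f (x, y))%E.
  rewrite /= !in_itv/= => /andP[x0 x1] y1.
  rewrite lee_fin; apply: mulr_ge0; first by rewrite lpow_ge0// x0 ltW.
  by rewrite mulr_ge0 ?exprn_ge0 ?onem_sqr_ge0// ltW// rquad_gt0.
move=> /(_ f0); apply: eq_measurable_fun => t; rewrite inE/= in_itv/=.
by move=> /andP[t0 _]; rewrite /f/= integral_kerint.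
Qed.

Lemma integrable_lpowB_kerint j i n :
  mu.-integrable `]0, 1[ (fun t => (lpowB j i t * kerint n t)%:E).
Proof.
rewrite lpowBE; case: ifPn => _; first exact: integrable_lpow_kerint.
rewrite (_ : (fun t => _) = cst 0%E); first exact: integrable0.
by apply/funext => t; rewrite mul0r.
Qed.

Definition moment (j n : nat) : R :=
  \int[mu]_(t in `]0%R, 1%R[) (lpow j t * kerint n t).

(** Write D = t d/dt. Since D L_j = - L_(j-1) and D tau = - [tau1], this is minus the bracket L_j D
    tau - tau D L_j, weighted by (1 - v^2)^(m+1). Applying D to the bracket leaves only L_j D^2 tau
    - tau D^2 L_j, with D^2 L_j = L_(j-2). *)
Definition boundary (m j : nat) v t : R :=
  (1 - v ^+ 2) ^+ m.+1 * (lpow j t * tau1 v t - lpowB j 1 t * tau v t).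

Definition boundary_derivative (m j : nat) v t : R :=
  (1 - v ^+ 2) ^+ m.+1 * (lpow j t * tau2 v t - lpowB j 2 t * tau v t) / t.

Lemma is_derive_boundary m j v t : 0 < t ->
  is_derive t 1 (fun t => - boundary m j v t) (boundary_derivative m j v t).
Proof.
move=> t0; have h := is_derive_tau v t0; have h1 := is_derive_tau1 v t0.
have l0 := is_derive_lpowB j 0 t0; have l1 := is_derive_lpowB j 1 t0.
rewrite lpowB0 in l0; rewrite /boundary.
notypeclasses refine (is_derive_eq _ _); first by derive_rules.
rewrite /boundary_derivative.
by field; rewrite gt_eqF.
Qed.

Lemma derivable_boundary_derivative m j v t : 0 < t ->
  derivable (boundary_derivative m j v) t 1.
Proof.
move=> t0; have h := is_derive_tau v t0.
have h1 : is_derive t 1 (tau2 v) ('D_1 (tau2 v) t).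
  exact/derivableP/derivable_tau2.
have l0 := is_derive_lpowB j 0 t0; have l1 := is_derive_lpowB j 2 t0.
have h5 := is_derive1V (lt0r_neq0 t0) (is_derive1_id t).
rewrite lpowB0 in l0.
suff [d []] : exists d, is_derive t 1 (boundary_derivative m j v) d by [].
by eexists; rewrite /boundary_derivative; derive_rules.
Qed.

Lemma measurable_boundary_derivative m j :
  let T := measurableTypeR R in
  measurable_fun [set: T * T] (fun z => boundary_derivative m j z.2 z.1).
Proof.
move=> T.
have mr : measurable_fun [set: T * T] (fun z => rquad z.2 z.1).
  by apply: measurable_rquad; measurable_rules.
have m0 : measurable_fun [set: T * T] (fun z => lpow j z.1).
  by apply: measurable_lpow; measurable_rules.
have m2 : measurable_fun [set: T * T] (fun z => lpowB j 2 z.1).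
  rewrite lpowBE; case: ifPn => _; last exact: measurable_cst.
  by apply: measurable_lpow; measurable_rules.
by rewrite /boundary_derivative /tau2 /tau; measurable_rules.
Qed.

Lemma bounded_boundary_derivative m j (e : R) : 0 < e ->
  bounded_on `[e, 1] `[-1, 1] (fun t v => boundary_derivative m j v t).
Proof.
move=> e0.
have bt : bounded_on `[e, 1] `[(-1)%R, 1%R] (fun t (v : R) => t).
  exists 1 => // t v /=; rewrite in_itv/= => /andP[et t1] _.
  by rewrite ger0_norm// (le_trans _ et)// ltW.
have bv : bounded_on `[e, 1] `[(-1)%R, 1%R] (fun (t : R) v => v).
  by exists 1 => // t v /= _; rewrite in_itv/= ler_norml.
have bV : bounded_on `[e, 1] `[(-1)%R, 1%R] (fun t (v : R) => t^-1).
  exists e^-1; first by rewrite invr_ge0 ltW.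
  move=> t v /=; rewrite in_itv/= => /andP[et t1] _.
  have t0 := lt_le_trans e0 et.
  by rewrite ger0_norm ?invr_ge0 ?(ltW t0)// lef_pV2.
have bL : bounded_on `[e, 1] `[(-1)%R, 1%R] (fun t (v : R) => ln t).
  exists `|ln e| => // t v /=; rewrite in_itv/= => /andP[et t1] _.
  have t0 := lt_le_trans e0 et.
  rewrite !ler0_norm ?ln_le0 ?(le_trans et)//.
  by rewrite lerN2 ler_ln// posrE.
have bl k : bounded_on `[e, 1] `[(-1)%R, 1%R] (fun t (v : R) => lpow k t).
  by rewrite /lpow; bounded_rules.
have bB : bounded_on `[e, 1] `[(-1)%R, 1%R] (fun t (v : R) => lpowB j 2 t).
  by rewrite lpowBE; case: ifPn => _; [exact: bl|bounded_rules].
have br : bounded_on `[e, 1] `[(-1)%R, 1%R] (fun t v => rquad v t).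
  exists (2 * e)^-1; first by rewrite invr_ge0 mulr_ge0// ltW.
  move=> t v /=; rewrite in_itv/= => /andP[et t1] _.
  have t0 := lt_le_trans e0 et.
  rewrite ger0_norm ?(ltW (rquad_gt0 v t0))// /rquad.
  have e20 : 0 < 2 * e by rewrite mulr_gt0.
  rewrite lef_pV2 ?posrE ?sqrtr_gt0 ?quad_gt0//.
  rewrite -(ger0_norm (ltW e20)) -sqrtr_sqr ler_sqrt ?(ltW (quad_gt0 v t0))//.
  apply: (@le_trans _ _ (4 * t ^+ 2)).
    by rewrite exprMn -natrX ler_pM2l// lerXn2r ?nnegrE// ltW.
  by rewrite /quad lerDr mulr_ge0// sqr_ge0.
by rewrite /boundary_derivative /tau2 /tau; bounded_rules; exact: bl.
Qed.

(** After Fubini the inner integral is over t, where [boundary_derivative] has the primitive -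
    [boundary]. Keeping e > 0 provides the bound needed for the exchange. *)
Lemma integral_boundary_derivative m j (e : R) : 0 < e < 1 ->
  (\int[mu]_(t in `[e, 1%R]) \int[mu]_(v in `[(-1)%R, 1%R])
     (boundary_derivative m j v t)%:E =
   \int[mu]_(v in `[(-1)%R, 1%R]) (boundary m j v e - boundary m j v 1)%:E)%E.
Proof.
move=> /andP[e0 e1].
have [M M0 hM] := bounded_boundary_derivative m j e0.
have fin (a : R) : (mu `[a, 1%R] < +oo)%E.
  by rewrite lebesgue_measure_itv/=; case: ifPn => // _; rewrite -EFinB ltry.
have mf : measurable_fun [set: measurableTypeR R * measurableTypeR R]
    (fun z => (boundary_derivative m j z.2 z.1)%:E).
  by apply/measurable_EFinP; exact: measurable_boundary_derivative.
etransitivity.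
  apply: (@bounded_fubini_in _ _ (measurableTypeR R) (measurableTypeR R) R
    mu mu `[e, 1%R] `[(-1)%R, 1%R] (measurable_itv _) (measurable_itv _)
    _ mf M M0 (fin _) (fin _)).
  by move=> t v ? ?; rewrite lee_fin; exact: hM.
apply: eq_integral => v _.
have pos t : e <= t <= 1 -> 0 < t by move=> /andP[et _]; exact: lt_le_trans et.
have dF t : e <= t <= 1 ->
    is_derive t 1 (fun t => - boundary m j v t) (boundary_derivative m j v t).
  by move=> /pos; exact: is_derive_boundary.
rewrite /= (FTC_derivable e1 dF) ?opprK 1?addrC// => t /pos.
exact: derivable_boundary_derivative.
Qed.

End moments.

(** * The two integrations by parts and the limit e -> 0 *)

Section moment_recurrence.
Context {R : realType}.
Implicit Types v t : R.
Local Notation mu := (@lebesgue_measure R).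

Definition recurrence_integrand (m j : nat) t : R :=
  let n := m.+2%:R in
  4 * n ^+ 2 * (lpow j t * kerint m.+2 t)
  - (8 * n ^+ 2 - 8 * n + 3) * (lpow j t * kerint m.+1 t)
  + 4 * (n - 1) ^+ 2 * (lpow j t * kerint m t)
  - lpowB j 2 t * kerint m.+1 t.

(** Every term of [concomitant] contains a positive power of 1 - v^2 and so vanishes at v = -1 and v
    = 1; the weight exponent m + 1 = n - 1 is at least 1. *)
Lemma integral_concomitant m t : 0 < t ->
  (\int[mu]_(v in `[(-1)%R, 1%R]) ((1 - v ^+ 2) ^+ m.+1 * tau2 v t
     - adjoint_weight m v * tau v t)%:E = 0)%E.
Proof.
move=> t0; have N11 : (-1 : R) < 1 by lra.
rewrite (FTC_derivable N11 (fun v _ => is_derive_concomitant m v t0)).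
  rewrite /concomitant /= sqrrN !expr1n subrr !expr0n/=.
  by rewrite !(mulr0, mul0r, oppr0, addr0, subr0).
by move=> v _; exact: derivable_concomitant_derivative.
Qed.

(** Since tau = t r, the integrand splits into multiples of (1 - v^2)^i r and the exact v-derivative
    of [concomitant] times L_j(t) / t; the latter integrates to zero. *)
Lemma integral_boundary_derivative_v m j t : 0 < t ->
  (\int[mu]_(v in `[(-1)%R, 1%R]) (boundary_derivative m j v t)%:E =
   (recurrence_integrand m j t)%:E)%E.
Proof.
move=> t0; rewrite /recurrence_integrand; set n : R := m.+2%:R.
pose k i v : R := (1 - v ^+ 2) ^+ i * rquad v t.
pose l v : R := (1 - v ^+ 2) ^+ m.+1 * tau2 v t - adjoint_weight m v * tau v t.
pose a := 4 * n ^+ 2 * lpow j t.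
pose b := - (8 * n ^+ 2 - 8 * n + 3) * lpow j t - lpowB j 2 t.
pose c := 4 * (n - 1) ^+ 2 * lpow j t.
have ik i (x : R) : mu.-integrable `[-1, 1] (fun v => (x * k i v)%:E).
  exact: (integrableZl _ _ (integrable_kerint i t0)).
have il : mu.-integrable `[-1, 1] (fun v => (l v)%:E).
  by apply: integrable_derivable => v _; exact: derivable_concomitant_derivative.
transitivity (\int[mu]_(v in `[(-1)%R, 1%R])
    ((a * k m.+2 v)%:E + (b * k m.+1 v)%:E + (c * k m v)%:E
     + (lpow j t / t)%:E * (l v)%:E))%E.
  apply: eq_integral => v _; rewrite -EFinM -!EFinD; congr EFin.
  rewrite /boundary_derivative /a /b /c /l /k /adjoint_weight /tau /=.
  by rewrite -/n; field; rewrite gt_eqF.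
rewrite integralD//; last 2 first.
  by apply: integrableD => //; apply: integrableD.
  exact: integrableZl.
rewrite integralD//; last exact: integrableD.
rewrite integralD// integralZl// integral_concomitant// mule0 adde0.
rewrite !integral_kerint// -!EFinD; congr EFin.
by rewrite /a /b /c; ring.
Qed.

(** At t = 1 the factor 1 - t^4 kills [tau1], Q = 4 gives tau = 1/2, and L_(j-1)(1) is nonzero only
    for j = 1; for j = 0 the default value 0 of [lpowB] intervenes. *)
Lemma boundary1 m j v :
  boundary m j v 1 = - ((j == 1%N)%:R / 2 * (1 - v ^+ 2) ^+ m.+1).
Proof.
have r1 : rquad v 1 = 1 / 2.
  rewrite /rquad /quad expr1n subrr expr0n mulr0 add0r mulr1.
  have -> : 4 = 2 ^+ 2 :> R by ring.
  by rewrite sqrtr_sqr ger0_norm// mul1r.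
rewrite /boundary /tau1 /tau r1 !expr1n subrr.
have -> : lpowB j 1 1 = (j == 1%N)%:R :> R.
  by rewrite /lpowB lpow1 subn_eq0; case: j => [|[]].
by field.
Qed.

Lemma integrable_boundary m j t : 0 < t ->
  mu.-integrable `[-1, 1] (fun v => (boundary m j v t)%:E).
Proof.
move=> t0; apply: integrable_derivable => v _.
have h := is_derive_rquad_v v t0.
suff [d []] : exists d, is_derive v 1 (fun v => boundary m j v t) d by [].
by eexists; rewrite /boundary /tau1 /tau; derive_rules.
Qed.

(** The 3 is the 2 of [tau1_le] plus 1 for the term with [tau] itself. *)
Lemma normr_boundary_le m j v t : -1 <= v <= 1 -> 0 < t <= 1 ->
  `|boundary m j v t| <= 3 * (4 ^+ j / root4 t) * tau v t.
Proof.
move=> v1 t01; have /andP[t0 t1] := t01.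
have tau0 := tau_ge0 v t0.
rewrite /boundary normrM ger0_norm; last by rewrite exprn_ge0// onem_sqr_ge0.
rewrite -[leRHS]mul1r ler_pM ?exprn_ge0 ?onem_sqr_ge0//.
  by rewrite exprn_ile1 ?onem_sqr_ge0 ?onem_sqr_le1.
apply: (le_trans (ler_normB _ _)); rewrite (normrM (lpow _ _)) (normrM (lpowB _ _ _)).
rewrite (ger0_norm tau0) (ger0_norm (lpow_ge0 _ t01)) (ger0_norm (lpowB_ge0 _ _ t01)).
have h1 : lpow j t * `|tau1 v t| <= 4 ^+ j / root4 t * (2 * tau v t).
  by rewrite ler_pM ?lpow_ge0 ?lpow_le ?tau1_le.
have h2 : lpowB j 1 t * tau v t <= 4 ^+ j / root4 t * tau v t.
  by rewrite ler_wpM2r ?lpowB_le.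
by apply: (le_trans (lerD h1 h2)); rewrite le_eqVlt; apply/orP; left; apply/eqP; ring.
Qed.

Lemma boundary_le m j t : 0 < t <= 1 ->
  `|\int[mu]_(v in `[(-1)%R, 1%R]) boundary m j v t| <=
  3 * 4 ^+ j * (pi + 1) * root4 t.
Proof.
move=> t01; have /andP[t0 t1] := t01.
have ib := integrable_boundary m j t0.
apply: (le_trans (le_normr_Rintegral _ ib)) => //.
have it : mu.-integrable `[-1, 1]
    (fun v => (3 * (4 ^+ j / root4 t) * tau v t)%:E).
  apply: integrable_derivable => v _.
  have h := is_derive_rquad_v v t0.
  suff [d []] : exists d, is_derive v 1
    (fun v => 3 * (4 ^+ j / root4 t) * tau v t) d by [].
  by eexists; rewrite /tau; derive_rules.
apply: (@le_trans _ _ (\int[mu]_(v in `[(-1)%R, 1%R])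
    (3 * (4 ^+ j / root4 t) * tau v t))).
  apply: le_Rintegral => //; first exact: integrable_norm.
  by move=> v /=; rewrite in_itv/= => v1; exact: normr_boundary_le.
have -> : \int[mu]_(v in `[(-1)%R, 1%R]) (3 * (4 ^+ j / root4 t) * tau v t) =
    3 * (4 ^+ j / root4 t) * (t * kerint 0 t).
  apply: EFin_inj; rewrite /Rintegral fineK; last exact: integrable_fin_num.
  rewrite (mulrA (3 * _)) -integral_kerint//; apply: eq_integral => v _.
  by rewrite /tau expr0; congr EFin; ring.
have q0 := root4_gt0 t.
apply: (@le_trans _ _ (3 * (4 ^+ j / root4 t) * (root4 t ^+ 2 * (pi + 1)))).
  have c0 : 0 < 3 * (4 ^+ j / root4 t) by rewrite mulr_gt0// divr_gt0// exprn_gt0.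
  by rewrite (ler_pM2l c0); exact: kerint0_le.
by rewrite le_eqVlt; apply/orP; left; apply/eqP; field; rewrite gt_eqF.
Qed.

Lemma integrable_recurrence_integrand m j :
  mu.-integrable `]0, 1[ (EFin \o recurrence_integrand m j).
Proof.
pose n : R := m.+2%:R.
have ik i (x : R) : mu.-integrable `]0, 1[
    (fun t => (x%:E * (lpow j t * kerint i t)%:E)%E).
  by apply: integrableZl => //; exact: integrable_lpow_kerint.
have := integrableB _ (integrableD _ (integrableB _ (ik m.+2 (4 * n ^+ 2))
  (ik m.+1 (8 * n ^+ 2 - 8 * n + 3))) (ik m (4 * (n - 1) ^+ 2)))
  (integrable_lpowB_kerint j 2 m.+1).
by apply.
Qed.

Lemma integral_recurrence_integrand m j (e : R) : 0 < e < 1 ->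
  \int[mu]_(t in `[e, 1]) recurrence_integrand m j t =
  \int[mu]_(v in `[(-1)%R, 1%R]) boundary m j v e
  - \int[mu]_(v in `[(-1)%R, 1%R]) boundary m j v 1.
Proof.
move=> e01; have /andP[e0 e1] := e01.
rewrite -RintegralB//; try exact: integrable_boundary.
congr fine; rewrite -integral_boundary_derivative//.
apply: eq_integral => t; rewrite inE/= in_itv/= => /andP[et _].
by rewrite integral_boundary_derivative_v// (lt_le_trans e0).
Qed.

(** Lets e tend to 0 in [integral_recurrence_integrand]: the missing piece over [0, e] is small by
    integrability, the boundary term at e by [boundary_le]. *)
Lemma integral_recurrence_integrand01 m j :
  \int[mu]_(t in `[0%R, 1%R]) recurrence_integrand m j t =
  - \int[mu]_(v in `[(-1)%R, 1%R]) boundary m j v 1.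
Proof.
set S := LHS; set c := RHS.
have ih := integrable_itv_closure (integrable_recurrence_integrand m j).
have h := parameterized_integral_cvg_left ltr01 ih.
apply/eqP; rewrite -subr_eq0 -normr_le0; apply/ler_addgt0Pl => eps eps0.
rewrite addr0.
pose C : R := 3 * 4 ^+ j * (pi + 1).
have C0 : 0 < C by rewrite !mulr_gt0 ?exprn_gt0// addr_gt0// pi_gt0.
(* For e <= dlt^4 the bound C t^(1/4) at t = e is at most eps / 2. *)
pose dlt := eps / (2 * C).
have dlt0 : 0 < dlt by rewrite divr_gt0// mulr_gt0.
have e20 : 0 < eps / 2 by rewrite divr_gt0.
have : \forall e \near (0 : R)^'+, `|S - c| <= eps.
  near=> e.
  have e0 : 0 < e by near: e; exact: nbhs_right_gt.
  have e1 : e < 1 by near: e; exact: nbhs_right_lt.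
  have e01 : 0 < e < 1 by rewrite e0.
  have e01' : 0 < e <= 1 by rewrite e0 ltW.
  have qe : root4 e <= dlt.
    rewrite -(@ler_pXn2r _ 4) ?nnegrE ?(ltW dlt0) ?(ltW (root4_gt0 e))//.
    rewrite root4_expr4//.
    by near: e; apply: nbhs_right_le; rewrite exprn_gt0.
  have he : `|\int[mu]_(t in `[0%R, e]) recurrence_integrand m j t| <= eps / 2.
    near: e; have /cvgr0Pnorm_le := cvg_at_right_filter h.
    by move=> /(_ _ e20).
  have SE : S - c = \int[mu]_(t in `[0%R, e]) recurrence_integrand m j t
      + \int[mu]_(v in `[(-1)%R, 1%R]) boundary m j v e.
    have := @Rintegral_itvB R (recurrence_integrand m j) (BLeft 0) (BRight 1) e ih.
    rewrite !bnd_simp (ltW e0) (ltW e1) => /(_ isT isT).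
    rewrite Rintegral_itv_obnd_cbnd; last first.
      apply: integrableS ih => //; by apply: subset_itv; rewrite bnd_simp.
    rewrite integral_recurrence_integrand// -/S /c opprK.
    by move/eqP; rewrite subr_eq => /eqP ->; ring.
  rewrite SE (le_trans (ler_normD _ _))// [leRHS]splitr lerD//.
  apply: (le_trans (boundary_le m j e01')); rewrite -/C.
  apply: (@le_trans _ _ (C * dlt)); first by rewrite ler_pM2l.
  by rewrite le_eqVlt; apply/orP; left; apply/eqP; rewrite /dlt; field; rewrite gt_eqF.
by move=> /filter_ex[].
Unshelve. all: by end_near. Qed.

End moment_recurrence.

(** * The beta integral and the recurrence for the moments *)

Section beta_integral.
Context {R : realType}.
Local Notation mu := (@lebesgue_measure R).

Lemma integrable_onem_sqr n :
  mu.-integrable `[-1, 1] (fun v => ((1 - v ^+ 2) ^+ n)%:E).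
Proof.
apply: integrable_derivable => v _.
suff [d []] : exists d, is_derive v 1 (fun v : R => (1 - v ^+ 2) ^+ n) d by [].
by eexists; derive_rules.
Qed.

(** The difference of the two integrands is the derivative of v (1 - v^2)^(n+1), which vanishes at
    both end points. *)
Lemma Rintegral_onem_sqrS n :
  (2 * n + 3)%N%:R * \int[mu]_(v in `[(-1)%R, 1%R]) ((1 - v ^+ 2) ^+ n.+1) =
  (2 * n + 2)%N%:R * \int[mu]_(v in `[(-1)%R, 1%R]) ((1 - v ^+ 2) ^+ n).
Proof.
apply/eqP; rewrite -subr_eq0; apply/eqP.
rewrite -!RintegralZl//; try exact: integrable_onem_sqr.
rewrite -RintegralB//; try exact: (integrableZl _ _ (integrable_onem_sqr _)).
have N11 : (-1 : R) < 1 by lra.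
have dF (v : R) : -1 <= v <= 1 -> is_derive v 1 (fun v : R => v * (1 - v ^+ 2) ^+ n.+1)
    ((2 * n + 3)%N%:R * (1 - v ^+ 2) ^+ n.+1
     - (2 * n + 2)%N%:R * (1 - v ^+ 2) ^+ n).
  move=> _; notypeclasses refine (is_derive_eq _ _); first by derive_rules.
  rewrite /= exprS.
  by set P := _ ^+ n; ring.
rewrite /Rintegral (FTC_derivable N11 dF) => [|v _].
  by rewrite /= sqrrN !expr1n subrr expr0n/= !mulr0 subrr.
suff [d []] : exists d, is_derive v 1 (fun v : R =>
    (2 * n + 3)%N%:R * (1 - v ^+ 2) ^+ n.+1
     - (2 * n + 2)%N%:R * (1 - v ^+ 2) ^+ n) d by [].
by eexists; derive_rules.
Qed.

Lemma double_factorial_gt0 n : (0 < double_factorial n)%N.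
Proof.
suff : (0 < double_factorial n)%N && (0 < double_factorial n.+1)%N.
  by case/andP.
by elim: n => //= n /andP[n0 n1]; rewrite n1 muln_gt0 n0.
Qed.

Lemma Rintegral_onem_sqr n :
  \int[mu]_(v in `[(-1)%R, 1%R]) ((1 - v ^+ 2) ^+ n) = 2 * J R 1 n.
Proof.
elim: n => [|n IHn].
  rewrite /J/= /Rintegral.
  under eq_integral do rewrite expr0.
  rewrite integral_cst//= lebesgue_measure_itv/= ifT ?lte_fin; last lra.
  by rewrite mul1e opprK divr1 mulr1.
apply: (@mulfI _ (2 * n + 3)%N%:R); first by rewrite pnatr_eq0 addn3.
rewrite Rintegral_onem_sqrS IHn /J.
rewrite (_ : 2 * n.+1 + 1 = (2 * n + 1).+2)%N; last by rewrite mulnS; ring.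
have -> : (double_factorial (2 * n + 1).+2 =
  (2 * n + 3) * double_factorial (2 * n + 1))%N by rewrite /= addn1 addn3.
rewrite expnS factS.
have : (double_factorial (2 * n + 1))%:R != 0 :> R.
  by rewrite pnatr_eq0 -lt0n double_factorial_gt0.
move: (double_factorial _) => D D0.
by field; rewrite D0/= -(natrM _ 2 n) -natrD pnatr_eq0 addn3.
Qed.

(** The right side anticipates the cases of [J R (k - 2)] with k = j + 2: zero for j = 0, the
    surviving boundary term for j = 1, a lower moment for j >= 2. The 1/2 of [boundary1] cancels the
    2 of [Rintegral_onem_sqr]. *)
Lemma moment_recurrence m j : let n := m.+2%:R : R in
  4 * n ^+ 2 * moment j m.+2 - (8 * n ^+ 2 - 8 * n + 3) * moment j m.+1
  + 4 * (n - 1) ^+ 2 * moment j m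
  = (if (2 <= j)%N then moment (j - 2) m.+1 else 0)
    + (j == 1%N)%:R * J R 1 m.+1.
Proof.
move=> n.
have ik i : mu.-integrable `]0, 1[ (EFin \o (fun t => lpow j t * kerint i t)).
  exact: integrable_lpow_kerint.
have ikZ i (x : R) : mu.-integrable `]0, 1[
    (EFin \o (fun t => x * (lpow j t * kerint i t))).
  exact: (integrableZl _ _ (integrable_lpow_kerint j i)).
have iB := integrable_lpowB_kerint (R := R) j 2 m.+1.
have -> : (if (2 <= j)%N then moment (j - 2) m.+1 else 0) =
    \int[mu]_(t in `]0%R, 1%R[) (lpowB j 2 t * kerint m.+1 t).
  rewrite lpowBE; case: ifPn => // _.
  by under eq_Rintegral do rewrite mul0r; rewrite Rintegral_cst// mul0r.
apply/eqP; rewrite [eqbRHS]addrC -subr_eq; apply/eqP.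
rewrite /moment -!RintegralZl// -RintegralB// -RintegralD//; last first.
  exact: (integrableB _ (ikZ _ _) (ikZ _ _)).
rewrite -RintegralB//; last first.
  exact: (integrableD _ (integrableB _ (ikZ _ _) (ikZ _ _)) (ikZ _ _)).
have := integral_recurrence_integrand01 (R := R) m j.
rewrite /Rintegral (@integral_itv_bndoo _ 0 1); last first.
  exact: measurable_int (integrable_recurrence_integrand m j).
move=> ->; rewrite -/(Rintegral _ _ _).
under eq_Rintegral do rewrite boundary1 -mulNr.
rewrite RintegralZl//; last exact: integrable_onem_sqr.
by rewrite Rintegral_onem_sqr; field.
Qed.

End beta_integral.

(** * Integrals over the cube *)

Section multiplicative_convolution.
Local Open Scope ereal_scope.
Context {R : realType}.
Local Notation T := (measurableTypeR R).
Local Notation mu := (@lebesgue_measure R).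

(** For fixed x the scaling t = x y produces the factor 1/x; Tonelli on the triangle 0 < t < x < 1
    then exchanges the variables. *)
Lemma integral_mul_var (Psi : T * T -> \bar R) : measurable_fun setT Psi ->
  (forall z, 0 <= Psi z) ->
  \int[mu]_(x in `]0%R, 1%R[) \int[mu]_(y in `]0%R, 1%R[) Psi (x, x * y)%R =
  \int[mu]_(t in `]0%R, 1%R[) \int[mu]_(x in `]t, 1%R[)
    ((x^-1)%:E * Psi (x, t)).
Proof.
move=> mPsi Psi0.
pose E : set (T * T) := [set z | ((0 < z.2) && (z.2 < z.1) && (z.1 < 1))%R].
have mE : measurable E.
  have m2 : measurable_fun [set: T * T] (fun z => z.2 : R) by exact: measurable_snd.
  have m1 : measurable_fun [set: T * T] (fun z => z.1 : R) by exact: measurable_fst.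
  have h : measurable_fun [set: T * T]
      (fun z => ((0 < z.2) && (z.2 < z.1) && (z.1 < 1))%R).
    apply: measurable_and; last exact: measurable_fun_ltr.
    by apply: measurable_and; exact: measurable_fun_ltr.
  rewrite (_ : E = setT `&` (fun z => ((0 < z.2) && (z.2 < z.1) && (z.1 < 1))%R)
     @^-1` [set true]); first exact: h.
  by rewrite setTI; apply/seteqP; split.
pose G z : \bar R := (z.1^-1)%:E * Psi z.
have mG : measurable_fun setT G.
  apply: emeasurable_funM => //; apply/measurable_EFinP/measurable_funV.
  exact: measurable_fst.
have mGE : measurable_fun setT (G \_ E) by exact: measurable_patchT.
have GE0 z : 0 <= (G \_ E) z.
  apply: erestrict_ge0 => -[x t] /andP[/andP[/= t0 tx] _].
  by rewrite mule_ge0// lee_fin invr_ge0 ltW// (lt_trans t0).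
transitivity (\int[mu]_x \int[mu]_t (G \_ E) (x, t)).
  rewrite integral_mkcond; apply: eq_integral => x _.
  rewrite /patch; case: ifPn => [|]; last first.
    rewrite notin_setE/= in_itv/= => /negP x01.
    rewrite integral0_eq// => t _; case: ifPn => //.
    rewrite inE /E/= => /andP[/andP[t0 tx] x1]; exfalso; apply: (negP x01).
    by rewrite x1 (lt_trans t0).
  rewrite inE/= in_itv/= => /andP[x0 x1].
  pose g t := ((fun t => Psi (x, t)) \_ `]0%R, x[) t.
  have mg : measurable_fun setT g.
    by apply: measurable_patchT => //; exact: measurableT_comp.
  have g0 t : 0 <= g t by apply: erestrict_ge0.
  transitivity (\int[mu]_y g (x * y)%R).
    rewrite integral_mkcond; apply: eq_integral => y _.
    rewrite /g /patch; congr (if _ then _ else _).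
    apply/idP/idP; rewrite !inE/= !in_itv/= pmulr_rgt0// => /andP[-> /=].
      by rewrite gtr_pMr.
    by rewrite gtr_pMr.
  rewrite integral_scale// -ge0_integralZl//; last by rewrite lee_fin invr_ge0 ltW.
  apply: eq_integral => t _; rewrite /g /patch.
  have -> : ((x, t) \in E) = (t \in `]0%R, x[%classic).
    by apply/idP/idP; rewrite !inE /E/= in_itv/= x1 andbT.
  by case: ifPn => // _; rewrite mule0.
rewrite fubini_tonelli// [RHS]integral_mkcond; apply: eq_integral => t _.
rewrite [in RHS]/patch; case: ifPn => [|]; last first.
  rewrite notin_setE/= in_itv/= => /negP t01.
  rewrite integral0_eq// => x _; rewrite /patch; case: ifPn => //.
  rewrite inE /E/= => /andP[/andP[t0 tx] x1]; exfalso; apply: (negP t01).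
  by rewrite t0 (lt_trans tx).
rewrite inE/= in_itv/= => /andP[t0 t1].
rewrite [RHS]integral_mkcond; apply: eq_integral => x _; rewrite /patch.
have -> // : ((x, t) \in E) = (x \in `]t, 1%R[%classic).
by apply/idP/idP; rewrite !inE /E/= in_itv/= t0.
Qed.

Lemma integral_lpow_div j (t : R) : (0 < t < 1)%R ->
  \int[mu]_(x in `]t, 1%R[) (x^-1 * lpow j x)%:E = (lpow j.+1 t)%:E.
Proof.
move=> /andP[t0 t1].
have pos x : (t <= x <= 1)%R -> (0 < x)%R.
  by move=> /andP[tx _]; exact: lt_le_trans tx.
have l1 x := @is_derive_lpowB R j.+1 0 x.
have dF (x : R) : (t <= x <= 1)%R ->
    is_derive x 1%R (fun x => - lpow j.+1 x)%R (x^-1 * lpow j x)%R.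
  move=> /pos x0; have := l1 _ x0; rewrite lpowB0 => h.
  notypeclasses refine (is_derive_eq _ _); first by derive_rules.
  by rewrite /lpowB /= subn1 opprK mulrC.
rewrite -(@integral_itv_bndoo _ t 1 _ true false); last first.
  apply/measurable_EFinP/measurable_funTS/measurable_mul.
    exact: inv_measurable.
  exact: measurable_lpow.
rewrite (FTC_derivable t1 dF).
  by rewrite lpow1 oppr0 add0r opprK.
move=> x /pos x0; have h5 := is_derive1V (lt0r_neq0 x0) (is_derive1_id x).
have := @is_derive_lpowB R j 0 x x0; rewrite lpowB0 => h.
suff [d []] : exists d, is_derive x 1%R (fun x => x^-1 * lpow j x)%R d by [].
by eexists; derive_rules.
Qed.

(** For odd [j] and x > 1, [lpow] is negative, while the lemmas above want integrands nonnegative on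
    the whole line. Integrands therefore carry an absolute value, removed here on ]0, 1[. *)
Lemma ger0_lpow j (x : R) : (0 < x < 1)%R -> `|lpow j x|%R = lpow j x.
Proof. by move=> /andP[x0 x1]; rewrite ger0_norm// lpow_ge0// x0 ltW. Qed.

(** One more uniform factor raises L_j to L_(j+1): after t = x y, the integral of L_j(x) / x over
    ]t, 1[ is L_(j+1)(t). *)
Lemma integral_lpow_mul j (f : T -> \bar R) : measurable_fun setT f ->
  (forall x, 0 <= f x) ->
  \int[mu]_(x in `]0%R, 1%R[) \int[mu]_(y in `]0%R, 1%R[)
    ((lpow j y)%:E * f (x * y)%R) =
  \int[mu]_(t in `]0%R, 1%R[) ((lpow j.+1 t)%:E * f t).
Proof.
move=> mf f0.
pose Psi (z : T * T) : \bar R := (`|lpow j z.1|)%:E * f z.2.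
have ml : measurable_fun [set: T * T] (fun z => (`|lpow j z.1|)%:E).
  apply/measurable_EFinP; apply: measurableT_comp => //.
  by apply: measurable_lpow; exact: measurable_fst.
have mPsi : measurable_fun setT Psi.
  by apply: emeasurable_funM => //; apply: measurableT_comp.
have Psi0 z : 0 <= Psi z by rewrite mule_ge0.
have mf' : measurable_fun [set: T * T] (fun z => Psi (z.2, z.2 * z.1)%R).
  apply: (measurableT_comp mPsi); apply/measurable_fun_pairP; split => /=.
    exact: measurable_snd.
  by apply: measurable_mul; [exact: measurable_snd|exact: measurable_fst].
transitivity (\int[mu]_(x in `]0%R, 1%R[) \int[mu]_(y in `]0%R, 1%R[)
    Psi (y, y * x)%R).
  apply: eq_integral => x _; apply: eq_integral => y; rewrite inE/= in_itv/= => y01.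
  by rewrite /Psi/= ger0_lpow// mulrC.
rewrite (@tonelli_in _ _ T T R mu mu `]0%R, 1%R[ `]0%R, 1%R[ (measurable_itv _)
   (measurable_itv _) _ mf')//=.
rewrite integral_mul_var//; apply: eq_integral => t.
rewrite inE/= in_itv/= => t01; have /andP[t0 t1] := t01.
transitivity (\int[mu]_(x in `]t, 1%R[) ((x^-1 * lpow j x)%:E * f t)).
  apply: eq_integral => x; rewrite inE/= in_itv/= => /andP[tx x1].
  by rewrite /Psi/= muleA -EFinM ger0_lpow// x1 (lt_trans t0).
rewrite ge0_integralZr ?integral_lpow_div//.
- apply/measurable_EFinP/measurable_funTS/measurable_mul.
    exact: inv_measurable.
  exact: measurable_lpow.
- move=> x /=; rewrite in_itv/= => /andP[tx x1].
  have x0 := lt_trans t0 tx.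
  rewrite lee_fin; apply: mulr_ge0; first by rewrite invr_ge0 ltW.
  by rewrite lpow_ge0// x0 ltW.
Qed.

End multiplicative_convolution.

Section cube.
Local Open Scope ereal_scope.
Context {R : realType}.
Local Notation T := (measurableTypeR R).
Local Notation mu := (@lebesgue_measure R).

Lemma measurable_unit_cube k : measurable (unit_cube R k).
Proof.
rewrite (_ : unit_cube R k = \bigcap_(i in [set: 'I_k])
    (fun u : k.-tuple T => tnth u i) @^-1` `[0%R, 1%R]).
  apply: fin_bigcap_measurable; first exact: finite_finset.
  by move=> i _; rewrite -[X in measurable X]setTI; exact: measurable_tnth.
apply/seteqP; split=> u /= h i; first by move=> _; rewrite /= in_itv/=; exact: h.
by have := h i I; rewrite /= in_itv/=.
Qed.

Lemma unit_cube_cons k :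
  @tcons T k @^-1` unit_cube R k.+1 = `[0%R, 1%R] `*` unit_cube R k.
Proof.
apply/seteqP; split=> -[x u] /=; rewrite in_itv/=.
  move=> h; split; first exact: (h ord0).
  by move=> i; have := h (lift ord0 i); rewrite /tcons tnthS.
move=> [x1 h] i; have [j ->|->//] := unliftP ord0 i.
by rewrite /tcons tnthS; exact: h.
Qed.

Lemma integral_cube_cons k (f : k.+1.-tuple T -> \bar R) :
  measurable_fun setT f -> (forall u, 0 <= f u) ->
  \int[lebesgue_tuple R k.+1]_(u in unit_cube R k.+1) f u =
  \int[mu]_(x in `]0%R, 1%R[) \int[lebesgue_tuple R k]_(u in unit_cube R k)
    f (tcons (x, u)).
Proof.
move=> mf f0.
have mft : measurable_fun setT (f \o @tcons T k).
  by apply: measurableT_comp => //; exact: measurable_tcons.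
rewrite [LHS](@ge0_integral_pushforward _ _ _ _ R _ (@measurable_tcons R k)
  (mu \x lebesgue_tuple R k)%E (unit_cube R k.+1) f) //; last 2 first.
  exact: measurable_unit_cube.
  exact: measurable_funTS.
rewrite unit_cube_cons (@integral_product_in _ _ T _ R mu (lebesgue_tuple R k)
  _ _ (measurable_itv _) (@measurable_unit_cube k) _ mft)//.
rewrite integral_itv_bndoo//.
apply: (@measurable_integral_in _ _ T _ R (lebesgue_tuple R k)
  _ _ (measurable_itv _) (@measurable_unit_cube k) _ mft).
all: by move=> x u _ _; exact: f0.
Qed.

Lemma integral_cube0 (f : 0.-tuple T -> \bar R) : measurable_fun setT f ->
  \int[lebesgue_tuple R 0]_(u in unit_cube R 0) f u = f [tuple].
Proof.
move=> mf; rewrite (_ : unit_cube R 0 = setT); last first.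
  by apply/seteqP; split=> // u _ [].
by rewrite /= integral_dirac// diracT mul1e.
Qed.

End cube.

Section cube_products.
Context {R : realType}.
Local Notation T := (measurableTypeR R).
Local Notation mu := (@lebesgue_measure R).

Definition prod_lt k (r : nat) (u : k.-tuple T) : R :=
  \prod_(i < k | (i < r)%N) (tnth u i : R).

Definition prod_ge k (r : nat) (u : k.-tuple T) : R :=
  \prod_(i < k | (r <= i)%N) (tnth u i : R).

Lemma prod_lt0 k (u : k.-tuple T) : prod_lt 0 u = 1.
Proof. by rewrite /prod_lt big_pred0. Qed.

Lemma prod_lt_cons k r (x : T) (u : k.-tuple T) :
  prod_lt r.+1 (tcons (x, u)) = (x : R) * prod_lt r u.
Proof.
rewrite /prod_lt big_mkcond big_ord_recl /=; congr (_ * _).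
by rewrite [RHS]big_mkcond; apply: eq_bigr => i _; rewrite /tcons tnthS.
Qed.

Lemma prod_ge_cons k r (x : T) (u : k.-tuple T) :
  prod_ge r.+1 (tcons (x, u)) = prod_ge r u.
Proof.
rewrite /prod_ge big_mkcond big_ord_recl /= mul1r.
by rewrite [RHS]big_mkcond; apply: eq_bigr => i _; rewrite /tcons tnthS.
Qed.

Lemma prod_ge0_cons k (x : T) (u : k.-tuple T) :
  prod_ge 0 (tcons (x, u)) = (x : R) * prod_ge 0 u.
Proof.
rewrite /prod_ge big_mkcond big_ord_recl /=; congr (_ * _).
by rewrite [RHS]big_mkcond; apply: eq_bigr => i _; rewrite /tcons tnthS.
Qed.

Lemma measurable_prod_lt k r : measurable_fun setT (@prod_lt k r).
Proof.
rewrite /prod_lt; under eq_fun do rewrite -big_filter.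
by apply: measurable_prod => i _; exact: measurable_tnth.
Qed.

Lemma measurable_prod_ge k r : measurable_fun setT (@prod_ge k r).
Proof.
rewrite /prod_ge; under eq_fun do rewrite -big_filter.
by apply: measurable_prod => i _; exact: measurable_tnth.
Qed.

Local Open Scope ereal_scope.

Lemma integral_cube_prod k (f : T -> \bar R) : measurable_fun setT f ->
  (forall x, 0 <= f x) ->
  \int[lebesgue_tuple R k.+1]_(u in unit_cube R k.+1) f (prod_ge 0 u) =
  \int[mu]_(t in `]0%R, 1%R[) ((lpow k t)%:E * f t).
Proof.
have mfp k' (g : T -> \bar R) : measurable_fun setT g ->
    measurable_fun setT (fun u : k'.-tuple T => g (prod_ge 0 u)).
  by move=> mg; apply: (measurableT_comp mg); exact: measurable_prod_ge.
have mfM (x : T) (g : T -> \bar R) : measurable_fun setT g ->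
    measurable_fun setT (fun y : T => g (x * y)%R).
  have mh : measurable_fun setT (fun y : T => (x * y)%R : T).
    exact: mulrl_measurable.
  by move=> mg; exact: (measurableT_comp mg mh).
elim: k f => [|k IHk] f mf f0.
  rewrite integral_cube_cons//; last exact: mfp.
  apply: eq_integral => x _; rewrite integral_cube0; last first.
    have -> : (fun u => f (prod_ge 0 (tcons (x, u)))) =
      (fun u : 0.-tuple T => (fun y => f (x * y)%R) (prod_ge 0 u)).
      by apply/funext => u; rewrite prod_ge0_cons.
    exact: (mfp _ (fun y => f (x * y)%R) (mfM x _ mf)).
  by rewrite prod_ge0_cons /prod_ge big_ord0 mulr1 /lpow expr0 divr1 mul1e.
rewrite integral_cube_cons//; last exact: mfp.
rewrite -integral_lpow_mul//; apply: eq_integral => x _.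
rewrite -(IHk (fun y => f (x * y)%R))//.
  by apply: eq_integral => u _; rewrite prod_ge0_cons.
exact: mfM.
Qed.

(** Induction on the first block only: once it is down to one coordinate, the rest of the cube is
    the second block and [integral_cube_prod] applies. *)
Lemma integral_cube_prod2 r m (Phi : T * T -> \bar R) :
  measurable_fun setT Phi -> (forall z, 0 <= Phi z) ->
  \int[lebesgue_tuple R (r.+1 + m.+1)]_(u in unit_cube R (r.+1 + m.+1))
    Phi (prod_lt r.+1 u, prod_ge r.+1 u) =
  \int[mu]_(x in `]0%R, 1%R[) ((lpow r x)%:E *
    \int[mu]_(y in `]0%R, 1%R[) ((lpow m y)%:E * Phi (x, y))).
Proof.
have mPp k i (P : T * T -> \bar R) : measurable_fun setT P ->
    measurable_fun setT (fun u : k.-tuple T => P (prod_lt i u, prod_ge i u)).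
  move=> mP; apply: (measurableT_comp mP); apply/measurable_fun_pairP.
  by split; [exact: measurable_prod_lt|exact: measurable_prod_ge].
elim: r Phi => [|r IHr] Phi mPhi Phi0.
  rewrite [LHS](@integral_cube_cons R m.+1)//; last exact: mPp.
  apply: eq_integral => x _.
  rewrite [X in X%:E * _](_ : _ = 1%R); last by rewrite /lpow expr0 divr1.
  rewrite mul1e -(@integral_cube_prod m (fun y => Phi (x, y)))//.
    by apply: eq_integral => u _; rewrite prod_lt_cons prod_ge_cons prod_lt0 mulr1.
  exact: measurableT_comp.
rewrite [LHS](@integral_cube_cons R (r.+1 + m.+1))//; last exact: mPp.
pose psi (s : T) := \int[mu]_(y in `]0%R, 1%R[) ((`|lpow m y|)%:E * Phi (s, y)).
have psiE s : psi s = \int[mu]_(y in `]0%R, 1%R[) ((lpow m y)%:E * Phi (s, y)).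
  by apply: eq_integral => y; rewrite inE/= in_itv/= => y01; rewrite ger0_lpow.
have ml : measurable_fun [set: T * T] (fun z => (`|lpow m z.2|)%:E).
  apply/measurable_EFinP; apply: measurableT_comp => //.
  by apply: measurable_lpow; exact: measurable_snd.
have mpsi : measurable_fun setT psi.
  apply: (@measurable_integral_in _ _ T T R mu setT `]0%R, 1%R[ measurableT
    (measurable_itv _) (fun z => (`|lpow m z.2|)%:E * Phi z)).
    exact: emeasurable_funM.
  by move=> x y _ _; rewrite mule_ge0.
have psi0 s : 0 <= psi s by apply: integral_ge0 => y _; rewrite mule_ge0.
under [RHS]eq_integral do rewrite -psiE.
rewrite -integral_lpow_mul//; apply: eq_integral => x _.
under [RHS]eq_integral do rewrite psiE.
rewrite -(IHr (fun z => Phi (x * z.1, z.2)%R))//.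
  by apply: eq_integral => u _; rewrite prod_lt_cons prod_ge_cons.
apply: measurableT_comp => //; apply/measurable_fun_pairP; split => /=.
  by apply: measurable_mul; [exact: measurable_cst|exact: measurable_fst].
exact: measurable_snd.
Qed.

End cube_products.

(** * The change of variables *)

Section substitution.
Context {R : realType}.
Local Notation T := (measurableTypeR R).
Local Notation mu := (@lebesgue_measure R).
Implicit Types x y t v : R.

Definition jker (n : nat) x y : R :=
  (1 - x ^+ 4) ^+ n * (1 - y ^+ 4) ^+ n / (1 - (x * y) ^+ 2) ^+ (2 * n + 1).

(** With a = (t/x)^2 and b = x^2 one has a b = t^2. Then (a - b)^2 + 4 a b = (a + b)^2 makes [quad]
    a perfect square, and (1 - a b)^2 - (a - b)^2 = (1 - a^2)(1 - b^2) turns 1 - v^2 into the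
    numerator factors of [jker]. *)
Definition vsub t x : R := ((t / x) ^+ 2 - x ^+ 2) / (1 - t ^+ 2).

Definition dvsub t x : R :=
  - (2 / x * ((t / x) ^+ 2 + x ^+ 2) / (1 - t ^+ 2)).

Lemma is_derive_vsub t x : 0 < x -> is_derive x 1 (vsub t) (dvsub t x).
Proof.
move=> x0; have h5 := is_derive1V (lt0r_neq0 x0) (is_derive1_id x).
rewrite /vsub; notypeclasses refine (is_derive_eq _ _); first by derive_rules.
rewrite /dvsub; set c := (1 - t ^+ 2)^-1.
by field; rewrite gt_eqF.
Qed.

Lemma derive1_vsub t x : 0 < x -> derive1 (vsub t) x = dvsub t x.
Proof. by move=> x0; rewrite derive1E; have [] := is_derive_vsub t x0. Qed.

Lemma derive1_vsub_cvg t x : 0 < x ->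
  {for x, continuous (derive1 (vsub t))}.
Proof.
move=> x0; rewrite /prop_for /continuous_at derive1_vsub//.
have h5 := is_derive1V (lt0r_neq0 x0) (is_derive1_id x).
have [d hd] : exists d, is_derive x 1 (dvsub t) d.
  by eexists; rewrite /dvsub; derive_rules.
have := is_derive1_continuous hd; apply: cvg_trans; apply: near_eq_cvg.
near=> y; rewrite derive1_vsub//; near: y; exact: lt_nbhsr.
Unshelve. all: by end_near. Qed.

Lemma vsub_decreasing t : 0 < t < 1 ->
  {in `[t, 1] &, {homo vsub t : x y /~ x < y}}.
Proof.
move=> /andP[t0 t1] x y; rewrite !in_itv/= => /andP[tx _] /andP[ty _] yx.
have y0 := lt_le_trans t0 ty; have x0 := lt_le_trans t0 tx.
rewrite /vsub ltr_pM2r; last by rewrite invr_gt0 subr_gt0 exprn_ilt1// ltW.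
rewrite ltrB//.
  rewrite ltr_pXn2r// ?nnegrE ?divr_ge0 ?ltW// ltr_pM2l//.
  by rewrite ltf_pV2.
by rewrite ltr_pXn2r// nnegrE ltW.
Qed.

(** The value 1/(a + b) of [rquad] cancels a + b in the Jacobian and leaves 2 / (x (1 - t^2)). The 2
    is offset by the initial 1/2, and 1 - t^2 is the odd factor in the exponent 2n + 1. *)
Lemma vsub_jker n t x : 0 < t < 1 -> 0 < x ->
  2^-1 * ((1 - vsub t x ^+ 2) ^+ n * rquad (vsub t x) t) * - dvsub t x
  = x^-1 * jker n x (t / x).
Proof.
move=> /andP[t0 t1] x0.
have x0' : x != 0 by rewrite gt_eqF.
have t2 : 0 < 1 - t ^+ 2 by rewrite subr_gt0 exprn_ilt1// ltW.
have t20 : 1 - t ^+ 2 != 0 by rewrite gt_eqF.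
have s0 : 0 < (t / x) ^+ 2 + x ^+ 2.
  by rewrite addr_gt0// exprn_gt0// divr_gt0.
have -> : rquad (vsub t x) t = ((t / x) ^+ 2 + x ^+ 2)^-1.
  rewrite /rquad (_ : quad _ _ = ((t / x) ^+ 2 + x ^+ 2) ^+ 2).
    by rewrite sqrtr_sqr ger0_norm// ltW.
  by rewrite /quad /vsub; field; rewrite x0' t20.
have -> : 1 - vsub t x ^+ 2 =
    (1 - x ^+ 4) * (1 - (t / x) ^+ 4) / (1 - t ^+ 2) ^+ 2.
  by rewrite /vsub; field; rewrite x0' t20.
have xt : x * (t / x) = t by rewrite mulrCA divff// mulr1.
have E (a b c : R) : (a * b / c ^+ 2) ^+ n = a ^+ n * b ^+ n * (c ^+ (2 * n))^-1.
  by rewrite !exprMn exprVn exprM.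
rewrite /jker xt E exprD expr1 invfM /dvsub.
move: (_ ^+ n) (_ ^+ n) (_ ^+ (2 * n))^-1 => A B C.
field; rewrite t20 x0'/= gt_eqF// addr_gt0 ?exprn_gt0//.
by rewrite mulr_gt0.
Qed.

Lemma jker_ge0 n x y : 0 <= x <= 1 -> 0 <= y <= 1 -> 0 <= jker n x y.
Proof.
move=> /andP[x0 x1] /andP[y0 y1].
have h z k : 0 <= z -> z <= 1 -> 0 <= 1 - z ^+ k.
  by move=> z0 z1; rewrite subr_ge0 exprn_ile1.
by rewrite divr_ge0 ?mulr_ge0 ?exprn_ge0 ?h// ?mulr_ge0// mulr_ile1.
Qed.

Lemma measurable_jker n : measurable_fun [set: T * T] (fun z => jker n z.1 z.2).
Proof.
have m1 : measurable_fun [set: T * T] (fun z => z.1 : R) by exact: measurable_fst.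
have m2 : measurable_fun [set: T * T] (fun z => z.2 : R) by exact: measurable_snd.
by rewrite /jker; measurable_rules.
Qed.

Lemma integral_jker n t : 0 < t < 1 ->
  (\int[mu]_(x in `]t, 1%R[) ((x^-1)%:E * (`|jker n x (t / x)|)%:E) =
   (2^-1 * kerint n t)%:E)%E.
Proof.
move=> t01; have /andP[t0 t1] := t01.
have t2 : 1 - t ^+ 2 != 0 by rewrite gt_eqF// subr_gt0 exprn_ilt1// ltW.
have mj : measurable_fun [set: T] (fun x => x^-1 * jker n x (t / x)).
  have mV : measurable_fun [set: T] (fun x => x^-1 : R) by exact: inv_measurable.
  have mi : measurable_fun [set: T] (fun x => x : R) by exact: measurable_id.
  by rewrite /jker; measurable_rules.
transitivity (\int[mu]_(x in `]t, 1%R[) (x^-1 * jker n x (t / x))%:E)%E.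
  apply: eq_integral => x; rewrite inE/= in_itv/= => /andP[tx x1].
  have x0 := lt_trans t0 tx; rewrite -EFinM ger0_norm//.
  apply: jker_ge0; first by rewrite !ltW.
  by rewrite divr_ge0 ?(ltW t0) ?(ltW x0)//= ler_pdivrMr// mul1r ltW.
rewrite -(@integral_itv_bndoo _ t 1 _ true false); last first.
  exact/measurable_EFinP/measurable_funTS.
rewrite -integral_kerint//.
have vt : vsub t t = 1 by rewrite /vsub divff ?gt_eqF// expr1n divff.
have v1 : vsub t 1 = -1.
  by rewrite /vsub divr1 expr1n -opprB mulNr divff.
have := @integration_by_substitution_decreasing R (vsub t)
  (fun v => 2^-1 * ((1 - v ^+ 2) ^+ n * rquad v t)) t 1 (ltW t1)
  (vsub_decreasing t01).
rewrite vt v1 => ->.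
- apply: eq_integral => x; rewrite inE/= in_itv/= => /andP[tx x1].
  have x0 := lt_le_trans t0 tx.
  by rewrite -vsub_jker// -derive1_vsub.
- move=> x; rewrite in_itv/= => /andP[tx _].
  exact: (derive1_vsub_cvg (lt_trans t0 tx)).
- apply/cvg_ex; eexists; apply: cvg_at_right_filter.
  exact: (derive1_vsub_cvg t0).
- apply/cvg_ex; eexists; apply: cvg_at_left_filter.
  exact: (derive1_vsub_cvg ltr01).
- split.
  + move=> x; rewrite in_itv/= => /andP[tx _].
    by have [] := is_derive_vsub t (lt_trans t0 tx).
  + apply: cvg_at_right_filter.
    exact: (is_derive1_continuous (is_derive_vsub t t0)).
  + apply: cvg_at_left_filter.
    exact: (is_derive1_continuous (is_derive_vsub t ltr01)).
- apply: continuous_in_subspaceT => v _.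
  have h := is_derive_rquad_v v t0.
  have [d hd] : exists d, is_derive v 1
      (fun v => 2^-1 * ((1 - v ^+ 2) ^+ n * rquad v t)) d.
    by eexists; derive_rules.
  exact: is_derive1_continuous hd.
Qed.

End substitution.

(** * From the cube integrals to the moments *)

Section J_moment.
Context {R : realType}.
Local Notation T := (measurableTypeR R).
Local Notation mu := (@lebesgue_measure R).

Lemma sum_lpow j (x y : R) : 0 < x -> 0 < y ->
  \sum_(i < j.+1) lpow i x * lpow (j - i) y = lpow j (x * y).
Proof.
move=> x0 y0; rewrite /lpow lnM ?posrE// opprD addrC exprDn mulr_suml.
apply: eq_bigr => i _.
have ij : (i <= j)%N by rewrite -ltnS.
rewrite -[_ *+ 'C(_, _)]mulr_natr.
have -> : ('C(j, i))%:R = (j`!)%:R / ((i`!)%:R * ((j - i)`!)%:R) :> R.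
  rewrite -(bin_fact ij) !natrM mulfK// mulf_neq0// pnatr_eq0 -lt0n fact_gt0//.
have f0 k : (k`!)%:R != 0 :> R by rewrite pnatr_eq0 -lt0n fact_gt0.
by field; rewrite !f0.
Qed.

(** Kept in the extended reals and with an absolute value, so that Tonelli applies before anything
    is known to be finite. *)
Definition Jterm (k r n : nat) : \bar R :=
  (\int[lebesgue_tuple R k]_(u in unit_cube R k)
    (`|jker n (prod_lt r u) (prod_ge r u)|)%:E)%E.

Lemma prod_in01 k (P : pred 'I_k) (u : k.-tuple T) : unit_cube R k u ->
  0 <= \prod_(i < k | P i) (tnth u i : R) <= 1.
Proof.
move=> h; elim/big_ind : _ => [|x y /andP[x0 x1] /andP[y0 y1]|i _].
- by rewrite ler01 lexx.
- by rewrite mulr_ge0// mulr_ile1.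
- exact: h.
Qed.

Lemma J_Jterm j n :
  J R j.+2 n = \sum_(r < j.+1) 2 ^+ j.+2 * fine (Jterm j.+2 r.+1 n).
Proof.
rewrite /J big_add1 /= big_mkord; apply: eq_bigr => r _; congr (_ * fine _).
apply: eq_integral => u; rewrite inE => hu.
have h1 := prod_in01 (fun i => (i < r.+1)%N) hu.
have h2 := prod_in01 (fun i => (r.+1 <= i)%N) hu.
rewrite ger0_norm ?jker_ge0//; congr EFin.
rewrite /jker !prodrXl; congr (_ / (1 - _ ^+ 2) ^+ _).
rewrite (bigID (fun i : 'I_j.+2 => (i < r.+1)%N)) /=; congr (_ * _).
by apply: eq_bigl => i; rewrite -leqNgt.
Qed.

Local Open Scope ereal_scope.

Lemma sum_Jterm j n :
  \sum_(r < j.+1) Jterm j.+2 r.+1 n = (2^-1 * moment j n)%:E.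
Proof.
pose Phi (z : T * T) : \bar R := (`|jker n z.1 z.2|)%:E.
have mPhi : measurable_fun setT Phi.
  by apply/measurable_EFinP; apply: measurableT_comp => //; exact: measurable_jker.
have Phi0 z : 0 <= Phi z by rewrite lee_fin.
pose f (r : nat) (z : T * T) : \bar R :=
  (`|lpow r z.1| * `|lpow (j - r) z.2|)%:E * Phi z.
have mf r : measurable_fun setT (f r).
  apply: emeasurable_funM => //; apply/measurable_EFinP; apply: measurable_mul.
    by apply: measurableT_comp => //; apply: measurable_lpow; exact: measurable_fst.
  by apply: measurableT_comp => //; apply: measurable_lpow; exact: measurable_snd.
have f0 r z : 0 <= f r z by rewrite mule_ge0// lee_fin mulr_ge0.
have mI : measurable (`]0%R, 1%R[%classic : set T) by exact: measurable_itv.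
have mfx r x : measurable_fun setT (fun y => f r (x, y)) by exact: measurableT_comp.
have JE (r : 'I_j.+1) : Jterm j.+2 r.+1 n =
    \int[mu]_(x in `]0%R, 1%R[) \int[mu]_(y in `]0%R, 1%R[) f r (x, y).
  have jr : (j.+2 = r.+1 + (j - r).+1)%N.
    by rewrite addSn addnS subnKC// -ltnS.
  rewrite [in LHS]jr /Jterm.
  rewrite (@integral_cube_prod2 R r (j - r) Phi)//.
  apply: eq_integral => x; rewrite inE/= in_itv/= => x01.
  rewrite -ge0_integralZl//.
  - apply: eq_integral => y; rewrite inE/= in_itv/= => y01.
    by rewrite /f/= !ger0_lpow// EFinM muleA.
  - apply: emeasurable_funM.
      exact/measurable_EFinP/measurable_funTS/measurable_lpow.
    by apply/measurable_funTS; apply: measurableT_comp.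
  - move=> y /=; rewrite in_itv/= => y01.
    by rewrite mule_ge0// lee_fin -ger0_lpow.
  - by rewrite lee_fin -ger0_lpow.
under eq_bigr do rewrite JE.
rewrite -(ge0_integral_sum mu mI (f := fun (r : 'I_j.+1) x =>
  \int[mu]_(y in `]0%R, 1%R[) f r (x, y))); last 2 first.
  by move=> r; apply: (@measurable_integral_in _ _ T T R mu _ _ mI mI _ (mf r)).
  by move=> r x _; exact: integral_ge0.
(* Second argument t = x y, so y is recovered as t / x; L_j(x y) is what the sum over [r] becomes by
   [sum_lpow]. *)
pose Psi (z : T * T) : \bar R := (`|lpow j z.2|)%:E * Phi (z.1, z.2 / z.1)%R.
have mPsi : measurable_fun setT Psi.
  apply: emeasurable_funM.
    apply/measurable_EFinP; apply: measurableT_comp => //.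
    by apply: measurable_lpow; exact: measurable_snd.
  apply: (measurableT_comp mPhi); apply/measurable_fun_pairP; split => /=.
    exact: measurable_fst.
  apply: measurable_mul; first exact: measurable_snd.
  by apply: measurable_funV; exact: measurable_fst.
have Psi0 z : 0 <= Psi z by rewrite mule_ge0.
transitivity (\int[mu]_(x in `]0%R, 1%R[) \int[mu]_(y in `]0%R, 1%R[)
    Psi (x, x * y)%R).
  apply: eq_integral => x; rewrite inE/= in_itv/= => x01.
  have /andP[x0 x1] := x01.
  rewrite -(ge0_integral_sum mu mI (f := fun (r : 'I_j.+1) y => f r (x, y)))//.
    apply: eq_integral => y; rewrite inE/= in_itv/= => y01.
    have /andP[y0 y1] := y01.
    rewrite /Psi/= mulrAC divff ?gt_eqF// mul1r ger0_lpow; last first.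
      by rewrite mulr_gt0//= mulr_ilt1// ltW.
    rewrite -sum_lpow// -sumEFin ge0_sume_distrl; last first.
      by move=> r _; rewrite lee_fin -(ger0_lpow _ x01) -(ger0_lpow _ y01) mulr_ge0.
    by apply: eq_bigr => r _; rewrite /f/= !ger0_lpow.
  by move=> r; exact: measurable_funTS.
rewrite integral_mul_var//.
transitivity (\int[mu]_(t in `]0%R, 1%R[)
    (2^-1%:E * (lpow j t * kerint n t)%:E)).
  apply: eq_integral => t; rewrite inE/= in_itv/= => t01.
  have /andP[t0 t1] := t01.
  transitivity ((lpow j t)%:E * \int[mu]_(x in `]t, 1%R[)
      ((x^-1)%:E * (`|jker n x (t / x)|)%:E)).
    rewrite -ge0_integralZl//.
    - by apply: eq_integral => x _; rewrite /Psi/= ger0_lpow// muleCA.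
    - apply/measurable_funTS/emeasurable_funM.
        by apply/measurable_EFinP; exact: inv_measurable.
      have mg : measurable_fun [set: T] (fun x : T => (x, t / x)%R : T * T).
        apply/measurable_fun_pairP; split => /=; first exact: measurable_id.
        by apply: measurable_mul; [exact: measurable_cst|exact: inv_measurable].
      exact: (measurableT_comp mPhi mg).
    - move=> x /=; rewrite in_itv/= => /andP[tx _].
      by rewrite mule_ge0// lee_fin invr_ge0 ltW// (lt_trans t0).
    - by rewrite lee_fin -ger0_lpow.
  by rewrite integral_jker// -!EFinM mulrCA.
rewrite integralZl//; last exact: integrable_lpow_kerint.
rewrite EFinM; congr (_ * _); rewrite /moment /Rintegral fineK//.
by apply: integrable_fin_num => //; exact: integrable_lpow_kerint.
Qed.

Local Open Scope ring_scope.

Lemma J_moment j n : J R j.+2 n = 2 ^+ j.+1 * moment j n.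
Proof.
have S := sum_Jterm j n.
have T0 (r : 'I_j.+1) : (0 <= Jterm j.+2 r.+1 n)%E.
  by apply: integral_ge0 => u _; rewrite lee_fin.
(* Each term is nonnegative and hence at most the sum, which [sum_Jterm] shows to be a real number;
   only now may [fine] pass through the sum. *)
have Tfin (r : 'I_j.+1) : Jterm j.+2 r.+1 n \is a fin_num.
  rewrite ge0_fin_numE//; apply: (@le_lt_trans _ _ (2^-1 * moment j n)%:E).
    by rewrite -S (bigD1 r)//= leeDl// sume_ge0.
  exact: ltry.
rewrite J_Jterm -mulr_sumr.
have -> : \sum_(r < j.+1) fine (Jterm j.+2 r.+1 n) = 2^-1 * moment j n.
  apply: EFin_inj; rewrite -S -sumEFin; apply: eq_bigr => r _.
  by rewrite fineK.
by rewrite exprSr -mulrA mulVKf.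
Qed.

End J_moment.

Unset Implicit Arguments.

Theorem theorem3p3 (R : realType) (k n : nat) (hk : (2 <= k)%N) (hn : (2 <= n)%N) :
  4 * n%:R ^+ 2 * J R k n
  - (8 * n%:R ^+ 2 - 8 * n%:R + 3) * J R k (n - 1)
  + 4 * (n%:R - 1) ^+ 2 * J R k (n - 2)
  = 4 * J R (k - 2) (n - 1).
Proof.
case: k hk => [|[|j]]// _; case: n hn => [|[|m]]// _.
rewrite !subSS !subn0 !J_moment.
transitivity (2 ^+ j.+1 * (4 * m.+2%:R ^+ 2 * moment j m.+2
  - (8 * m.+2%:R ^+ 2 - 8 * m.+2%:R + 3) * moment j m.+1
  + 4 * (m.+2%:R - 1) ^+ 2 * moment j m) : R); first by ring.
(* The cases are k = 2, with [J] at index 0 equal to 0; k = 3, where 2^(k-1) is itself the factor 4;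
   and k >= 4, where 2^(k-1) = 4 times the 2^(k-3) belonging to index k - 2. *)
rewrite moment_recurrence; case: j => [|[|j]]; rewrite ?J_moment /=.
- by rewrite mul0r addr0 !mulr0.
- by rewrite mul1r add0r; ring.
- by rewrite mul0r addr0 subn2/= !exprS; ring.
Qed.
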